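(* For a virtual knot diagram $K$, the isomorphism class of the indexed knot quandle $IndQ_K$ is preserved under generalized Reidemeister moves; hence it is a virtual knot invariant.
   Context: An indexed quandle is a set $Q$ with binary operations $\ast_i$ ($i\in\mathbb{Z}$) such that: (1) $a\ast_0 a=a$ for all $a$; (2) for all $b,c\in Q$ and $i\in\mathbb{Z}$ there is a unique $a$ with $a\ast_i b=c$; (3) for all $a,b,c\in Q$ and $i,j\in\mathbb{Z}$, $(a\ast_i b)\ast_j c=(a\ast_j c)\ast_i(b\ast_{j-i}c)$. Homomorphisms preserve all $\ast_i$. Chord index of a real crossing $c$ of a virtual knot diagram: in the Gauss diagram (counterclockwise circle, one chord per real crossing directed from over- to under-preimage and signed by the writhe), let $r_\pm(c)$ (resp. $l_\pm(c)$) be the number of chords of sign $\pm$ whose endpoints interlace with those of $c$ and whose tail lies left (resp. right) of the arrow $c$ and head right (resp. left); $\mathrm{Ind}(c)=r_+(c)-r_-(c)-l_+(c)+l_-(c)$. Arcs of $K$ are the pieces of the diagram running from one undercrossing to the next (passing through overcrossings and virtual crossings). $IndQ_K$ is the indexed quandle generated by the arcs with one relation per real crossing $c$: if $c$ has index $i$, the over-arc is $b$, the under-arc lying to the right of the over-arc (with respect to the orientation of the over-arc) is $a$ and the other under-arc is $a'$, the relation is $a'=a\ast_i b$. Generalized Reidemeister moves: $\Omega_1,\Omega_2,\Omega_3$, the purely virtual moves and the mixed move $\Omega_3^v$. *)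

(* Defs.v *)
From HB Require Import structures.
From mathcomp Require Import all_boot all_order all_algebra.
From Stdlib Require Import Relations.
Set Implicit Arguments. Unset Strict Implicit. Unset Printing Implicit Defensive.
Import GRing.Theory Num.Theory.
Local Open Scope ring_scope.

(* A Gauss diagram is encoded as a cyclic Gauss word: the sequence of   *)
(* preimages of real crossings met along the (counterclockwise, knot-   *)
(* oriented) circle.  A letter (c, o, s) records the crossing label c,  *)
(* whether this preimage is the over-passage (o = true, the tail of the *)
(* chord) or the under-passage (o = false, the head of the chord), and  *)
(* the writhe sign s of the crossing (true = +1, false = -1).           *)
(* Virtual crossings do not appear in the Gauss diagram.                *)

Definition gletter := (nat * bool * bool)%type.
Definition gword := seq gletter.

Definition glab (x : gletter) : nat := x.1.1.
Definition gover (x : gletter) : bool := x.1.2.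
Definition gpos (x : gletter) : bool := x.2.

Definition gwf (w : gword) : Prop :=
  forall x, x \in w ->
    [/\ count (fun y => glab y == glab x) w = 2%N,
        count (pred1 (glab x, true, gpos x)) w = 1%N &
        count (pred1 (glab x, false, gpos x)) w = 1%N].

Definition labels (w : gword) : seq nat := undup [seq glab x | x <- w].

Definition overPos (w : gword) (c : nat) : nat :=
  find (fun x => (glab x == c) && gover x) w.
Definition underPos (w : gword) (c : nat) : nat :=
  find (fun x => (glab x == c) && ~~ gover x) w.
Definition csign (w : gword) (c : nat) : bool :=
  gpos (nth (0%N, false, false) w (overPos w c)).

(* Arcs.  An arc runs from one undercrossing to the next.  The arc      *)
(* starting at the under-passage of crossing c is named [Some c]; when  *)
(* the diagram has no real crossing there is a single arc, [None].      *)

Definition isArc (w : gword) (a : option nat) : bool :=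
  match a with None => w == [::] | Some c => c \in labels w end.

Definition lastUnder (s : gword) : option nat :=
  let u := [seq glab x | x <- s & ~~ gover x] in
  if u is nil then None else Some (last 0%N u).

(* the arc containing position p of the circle: it starts at the last   *)
(* under-passage met (cyclically) when going backwards from p           *)
Definition arcAt (w : gword) (p : nat) : option nat := lastUnder (rot p w).

(* over-arc of crossing c, and incoming under-arc (ending at c);        *)
(* the outgoing under-arc is [Some c].                                  *)
Definition overArc (w : gword) (c : nat) : option nat := arcAt w (overPos w c).
Definition inArc (w : gword) (c : nat) : option nat := arcAt w (underPos w c).

(* Chord index.  Rotate the word so that the tail of chord c is first;  *)
(* points met counterclockwise strictly between tail and head of c lie  *)
(* to the RIGHT of the arrow c, the others (strictly between head and   *)
(* tail) to its LEFT.                                                   *)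

Definition rightOf (w : gword) (c : nat) : gword :=
  let s := rot (overPos w c) w in take (underPos s c).-1 (drop 1 s).
Definition leftOf (w : gword) (c : nat) : gword :=
  let s := rot (overPos w c) w in drop (underPos s c).+1 s.

Definition nchords (A B : gword) (b : bool) : nat :=
  count (fun x => gover x && (gpos x == b) && ((glab x, false, gpos x) \in B)) A.

Definition r_ (w : gword) (c : nat) (b : bool) : nat := nchords (leftOf w c) (rightOf w c) b.
Definition l_ (w : gword) (c : nat) (b : bool) : nat := nchords (rightOf w c) (leftOf w c) b.

Definition Ind (w : gword) (c : nat) : int :=
  (r_ w c true)%:Z - (r_ w c false)%:Z - (l_ w c true)%:Z + (l_ w c false)%:Z.

Definition is_indexed_quandle (Q : Type) (op : int -> Q -> Q -> Q) : Prop :=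
  [/\ (forall a, op 0 a a = a),
      (forall (i : int) b c, exists! a, op i a b = c) &
      (forall (i j : int) a b c, op j (op i a b) c = op i (op j a c) (op (j - i) b c))].

Definition iq_hom (Q X : Type) (opQ : int -> Q -> Q -> Q) (opX : int -> X -> X -> X)
  (f : Q -> X) : Prop :=
  forall i a b, f (opQ i a b) = opX i (f a) (f b).

Definition iq_iso (Q X : Type) (opQ : int -> Q -> Q -> Q) (opX : int -> X -> X -> X)
  (f : Q -> X) : Prop := iq_hom opQ opX f /\ bijective f.

(* The crossing relations of IndQ_K: at crossing c of index i with      *)
(* over-arc b, under-arc a on the right of the over-arc and other       *)
(* under-arc a', the relation is a' = a *_i b.  For a positive crossing *)
(* the right under-arc is the incoming one, for a negative crossing the *)
(* outgoing one.                                                        *)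
Definition iq_rels (w : gword) (X : Type) (op : int -> X -> X -> X)
  (g : option nat -> X) : Prop :=
  forall c, c \in labels w ->
    if csign w c
    then g (Some c) = op (Ind w c) (g (inArc w c)) (g (overArc w c))
    else g (inArc w c) = op (Ind w c) (g (Some c)) (g (overArc w c)).

(* (Q, op, g) is (a model of) IndQ_K: the indexed quandle generated by   *)
(* the arcs of K subject to the crossing relations, i.e. it satisfies    *)
(* the universal property of the presentation.                           *)
Definition presents_IndQ (w : gword) (Q : Type) (op : int -> Q -> Q -> Q)
  (g : option nat -> Q) : Prop :=
  [/\ is_indexed_quandle op,
      iq_rels w op g &
      forall (X : Type) (opX : int -> X -> X -> X) (f : option nat -> X),
        is_indexed_quandle opX -> iq_rels w opX f ->
        exists! h : Q -> X, iq_hom op opX h /\ (forall a, isArc w a -> h (g a) = f a)].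

(* Generalized Reidemeister moves on Gauss diagrams.  Purely virtual    *)
(* moves and the mixed move do not change the Gauss diagram; Omega1,    *)
(* Omega2, Omega3 act as below.  Gauss words are cyclic and labels are  *)
(* names only, hence rotation and injective relabelling.                *)

Definition relab (f : nat -> nat) (x : gletter) : gletter := (f (glab x), gover x, gpos x).

(* Omega3: three strands 1,2,3 pairwise crossing at P12 (label p),      *)
(* P13 (label q), P23 (label r).  hij : strand i passes over strand j.  *)
(* si : orientation of strand i (strand 1 meets P12 before P13 iff s1,  *)
(* strand 2 meets P12 before P23 iff s2, strand 3 meets P13 before P23  *)
(* iff s3), t : orientation of the triangle.  Writing +-1 for booleans, *)
(* the writhe of Pij is (+-hij)(+-si)(+-sj)(+-t).                       *)
Definition tsign (hij si sj t : bool) : bool := ~~ (hij (+) si (+) sj (+) t).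

Definition tri_segs (p q r : nat) (s1 s2 s3 t h12 h13 h23 : bool) :
  gword * gword * gword :=
  let g12 := tsign h12 s1 s2 t in
  let g13 := tsign h13 s1 s3 t in
  let g23 := tsign h23 s2 s3 t in
  let A12 := (p, h12, g12) in let A13 := (q, h13, g13) in
  let B12 := (p, ~~ h12, g12) in let B23 := (r, h23, g23) in
  let C13 := (q, ~~ h13, g13) in let C23 := (r, ~~ h23, g23) in
  (if s1 then [:: A12; A13] else [:: A13; A12],
   if s2 then [:: B12; B23] else [:: B23; B12],
   if s3 then [:: C13; C23] else [:: C23; C13]).

(* the height relation must be a linear order (no cyclic triangle) *)
Definition acyclic3 (h12 h13 h23 : bool) : bool :=
  ~~ [&& h12, h23 & ~~ h13] && ~~ [&& ~~ h12, ~~ h23 & h13].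

Inductive gstep : gword -> gword -> Prop :=
| GSrot (n : nat) (w : gword) : gstep w (rot n w)
| GSrelab (f : nat -> nat) (w : gword) : injective f -> gstep w (map (relab f) w)
| GSR1a (u v : gword) (x : nat) (s : bool) :
    gwf (u ++ v) -> gwf (u ++ [:: (x, true, s); (x, false, s)] ++ v) ->
    gstep (u ++ v) (u ++ [:: (x, true, s); (x, false, s)] ++ v)
| GSR1b (u v : gword) (x : nat) (s : bool) :
    gwf (u ++ v) -> gwf (u ++ [:: (x, false, s); (x, true, s)] ++ v) ->
    gstep (u ++ v) (u ++ [:: (x, false, s); (x, true, s)] ++ v)
| GSR2a (u1 u2 u3 : gword) (x y : nat) (s : bool) :
    gwf (u1 ++ u2 ++ u3) ->
    gwf (u1 ++ [:: (x, true, s); (y, true, ~~ s)] ++ u2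
            ++ [:: (x, false, s); (y, false, ~~ s)] ++ u3) ->
    gstep (u1 ++ u2 ++ u3)
          (u1 ++ [:: (x, true, s); (y, true, ~~ s)] ++ u2
              ++ [:: (x, false, s); (y, false, ~~ s)] ++ u3)
| GSR2b (u1 u2 u3 : gword) (x y : nat) (s : bool) :
    gwf (u1 ++ u2 ++ u3) ->
    gwf (u1 ++ [:: (x, true, s); (y, true, ~~ s)] ++ u2
            ++ [:: (y, false, ~~ s); (x, false, s)] ++ u3) ->
    gstep (u1 ++ u2 ++ u3)
          (u1 ++ [:: (x, true, s); (y, true, ~~ s)] ++ u2
              ++ [:: (y, false, ~~ s); (x, false, s)] ++ u3)
| GSR3 (u1 u2 u3 u4 : gword) (p q r : nat) (s1 s2 s3 t h12 h13 h23 : bool)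
       (S1 S2 S3 : gword) :
    tri_segs p q r s1 s2 s3 t h12 h13 h23 = (S1, S2, S3) ->
    acyclic3 h12 h13 h23 ->
    gwf (u1 ++ S1 ++ u2 ++ S2 ++ u3 ++ S3 ++ u4) ->
    gstep (u1 ++ S1 ++ u2 ++ S2 ++ u3 ++ S3 ++ u4)
          (u1 ++ rev S1 ++ u2 ++ rev S2 ++ u3 ++ rev S3 ++ u4).

Definition greid_equiv : gword -> gword -> Prop := clos_refl_sym_trans gword gstep.

(* Main.v *)
Require Import Defs.
From mathcomp Require Import all_boot all_order all_algebra.
From mathcomp Require Import zify ring.
From Stdlib Require Import Relations.

Set Implicit Arguments. Unset Strict Implicit. Unset Printing Implicit Defensive.
Import GRing.Theory.
Local Open Scope ring_scope.

(** Give an under-passage of sign [s] the weight [s] and an over-passage the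
    weight [-s]. Chords lying on one side of [c] cancel, so [Ind c] is the total
    weight of the letters between the tail and the head of [c]; as the total
    weight of the word is [0], it is also the difference of the prefix sums
    ("heights") at the two passages of [c], corrected by the sign of [c]. Thus a
    crossing relation only depends on the two local states (height, colour) at
    the crossing, and invariance of colourings becomes a statement about tangles
    with arbitrary incoming states. For the third move, additivity of heights
    around the triangle says that the index of the top-bottom crossing is the
    sum of the other two, which is what the distributivity axiom requires.
    Natural bijections between colourings transport the universal property, so
    diagrams related by a move are presented by one and the same quandle. *)

(** * Well-formed Gauss words *)

Section GaussWords.

Lemma gletter_eta (x : gletter) : x = (glab x, gover x, gpos x).
Proof. by case: x => [[]]. Qed.

Lemma gwf_count w x : gwf w -> x \in w -> count_mem x w = 1%N.
Proof.
move=> Hw /Hw [_ H1 H2]; rewrite [in LHS](gletter_eta x).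
by case: (gover x).
Qed.

Lemma gwf_uniq w : gwf w -> uniq w.
Proof.
move=> Hw; apply: count_mem_uniq => x.
by case: (boolP (x \in w)) => [/(gwf_count Hw) //|/count_memPn].
Qed.

Lemma gwf_mate w x o : gwf w -> x \in w -> (glab x, o, gpos x) \in w.
Proof.
move=> Hw /Hw [_ H1 H2]; rewrite -has_pred1 has_count.
by case: o; rewrite ?H1 ?H2.
Qed.

(** The label of [x] occurs only twice, and the two passages carrying the sign of [x] already
    account for both occurrences. *)
Lemma gwf_sign w x y : gwf w -> x \in w -> y \in w -> glab x = glab y ->
  gpos x = gpos y.
Proof.
move=> Hw xw yw xy; have [Hc _ _] := Hw _ xw.
pose s2 := [seq z <- w | glab z == glab x].
have sub : {subset [:: (glab x, true, gpos x); (glab x, false, gpos x)] <= s2}.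
  move=> z; rewrite !inE mem_filter => /orP [] /eqP ->;
    by rewrite /= /glab /= eqxx gwf_mate.
have sz : (size s2 <= 2)%N by rewrite size_filter Hc.
have [|_ E] := uniq_min_size _ sub sz; first by rewrite /= inE !xpair_eqE andbF.
have : y \in s2 by rewrite mem_filter xy eqxx.
by rewrite -E !inE => /orP [] /eqP ->.
Qed.

Lemma gwf_perm w w' : perm_eq w w' -> gwf w -> gwf w'.
Proof.
move=> ww' Hw x; rewrite -(perm_mem ww') => /Hw.
by rewrite !(permP ww').
Qed.

Lemma labelsP w c :
  reflect (exists2 x, x \in w & c = glab x) (c \in labels w).
Proof. by rewrite /labels mem_undup; apply: mapP. Qed.

Lemma labels_letter w c : gwf w -> c \in labels w ->
  exists b, (c, true, b) \in w.
Proof.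
by move=> Hw /labelsP [x xw ->]; exists (gpos x); apply: gwf_mate.
Qed.

Lemma letter_labels w c o b : (c, o, b) \in w -> c \in labels w.
Proof. by move=> H; apply/labelsP; exists (c, o, b). Qed.

Lemma find_letter w c o b : gwf w -> (c, o, b) \in w ->
  find (fun x => (glab x == c) && (gover x == o)) w = index (c, o, b) w.
Proof.
move=> Hw cw; apply: eq_in_find => x xw /=.
apply/andP/eqP => [[/eqP E1 /eqP E2]|-> //].
by rewrite [x]gletter_eta (gwf_sign Hw xw cw E1) E1 E2.
Qed.

Lemma overPosE w c b : gwf w -> (c, true, b) \in w ->
  overPos w c = index (c, true, b) w.
Proof.
move=> Hw cw; rewrite -(find_letter Hw cw); apply: eq_find => x.
by rewrite eqb_id.
Qed.

Lemma underPosE w c b : gwf w -> (c, false, b) \in w ->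
  underPos w c = index (c, false, b) w.
Proof.
move=> Hw cw; rewrite -(find_letter Hw cw); apply: eq_find => x.
by rewrite eqbF_neg.
Qed.

Lemma csignE w c b : gwf w -> (c, true, b) \in w -> csign w c = b.
Proof. by move=> Hw cw; rewrite /csign (overPosE Hw cw) nth_index. Qed.

End GaussWords.

(** * Heights and chord counts *)

Section Index.

Definition sg (b : bool) : int := if b then 1 else -1.
Definition wt (y : gletter) : int := if gover y then - sg (gpos y) else sg (gpos y).
Definition height (s : gword) : int := \sum_(y <- s) wt y.

Lemma height_cat s t : height (s ++ t) = height s + height t.
Proof. by rewrite /height big_cat. Qed.

Lemma height_cons y s : height (y :: s) = wt y + height s.
Proof. by rewrite /height big_cons. Qed.

Lemma height_count s : height s =
  (count (fun y => ~~ gover y && (gpos y == true)) s)%:Z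
  - (count (fun y => ~~ gover y && (gpos y == false)) s)%:Z
  - (count (fun y => gover y && (gpos y == true)) s)%:Z
  + (count (fun y => gover y && (gpos y == false)) s)%:Z.
Proof.
elim: s => [|y s IH]; first by rewrite /height big_nil.
rewrite height_cons IH /= /wt /sg.
case: (gover y); case: (gpos y); rewrite /= ?PoszD; ring.
Qed.

(** Passing to the mate matches the over-passages of [A ++ B] with head in [A] with the
    under-passages of [A]; these are then sorted by the side on which the tail lies. *)
Lemma count_under_mate (A B : gword) (b : bool) :
  uniq (A ++ B) ->
  (forall x o, x \in A ++ B -> (glab x, o, gpos x) \in A ++ B) ->
  count (fun y => ~~ gover y && (gpos y == b)) A =
  (count (fun x => gover x && (gpos x == b) && ((glab x, false, gpos x) \in A)) A
   + nchords B A b)%N.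
Proof.
move=> U M; rewrite /nchords -count_cat -!size_filter.
set P := (X in size (filter X (A ++ B))).
rewrite -(size_map (fun x : gletter => (glab x, false, gpos x)) (filter P _)).
apply: perm_size; apply: uniq_perm.
- by rewrite filter_uniq //; move: U; rewrite cat_uniq => /andP [].
- rewrite map_inj_in_uniq ?filter_uniq // => x y; rewrite !mem_filter.
  case/andP => /andP [/andP [xo _] _] _; case/andP => /andP [/andP [yo _] _] _ [E1 E2].
  by rewrite [x]gletter_eta [y]gletter_eta xo yo E1 E2.
- move=> y; apply/idP/mapP => [|[x]].
    rewrite mem_filter => /andP [/andP [yo yb] yA].
    have Ey : (glab y, false, gpos y) = y.
      by rewrite {3}[y]gletter_eta (negbTE yo).
    exists (glab y, true, gpos y); last by rewrite [RHS]Ey.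
    by rewrite mem_filter /P /= /gpos /= -/(gpos y) yb Ey yA M // mem_cat yA.
  rewrite !mem_filter => /andP [/andP [/andP [xo xb] xA] _] ->.
  by rewrite xA /= xb.
Qed.

(** Here the over-passages of [A] are sorted by their head, which lies in exactly one of [A] and
    [B]. *)
Lemma count_over_mate (A B : gword) (b : bool) :
  uniq (A ++ B) ->
  (forall x o, x \in A ++ B -> (glab x, o, gpos x) \in A ++ B) ->
  count (fun y => gover y && (gpos y == b)) A =
  (count (fun x => gover x && (gpos x == b) && ((glab x, false, gpos x) \in A)) A
   + nchords A B b)%N.
Proof.
move=> U M; rewrite /nchords -count_predUI.
rewrite [X in (_ + X)%N](_ : _ = 0%N) ?addn0.
  apply: eq_in_count => x xA /=; have := M x false.
  rewrite !mem_cat xA => /(_ isT) /=.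
  by case: (gover x); case: (gpos x == b); do 2!case: (_ \in _).
apply/eqP; rewrite -leqn0 leqNgt -has_count -all_predC; apply/allP => x _ /=.
apply/negP => /andP [/andP [_ zA] /andP [_ zB]].
move: U; rewrite cat_uniq => /and3P [_ /negP D _].
by apply: D; apply/hasP; exists (glab x, false, gpos x).
Qed.

(* Chords with both ends in [A] contribute [0] to the height of [A]. *)
Lemma nchords_height (A B : gword) :
  uniq (A ++ B) ->
  (forall x o, x \in A ++ B -> (glab x, o, gpos x) \in A ++ B) ->
  (nchords B A true)%:Z - (nchords B A false)%:Z
  - (nchords A B true)%:Z + (nchords A B false)%:Z = height A.
Proof.
move=> U M; rewrite height_count !(count_under_mate _ U M) !(count_over_mate _ U M).
rewrite !PoszD; ring.
Qed.

(** With [B] empty no chord joins the two sides, so all four chord counts vanish. *)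
Lemma height_gwf w : gwf w -> height w = 0.
Proof.
move=> Hw; rewrite -(@nchords_height w [::]) ?cats0.
- rewrite /nchords /= !(eq_count (a2 := pred0)) ?count_pred0 // => x;
    by rewrite !andbF.
- exact: gwf_uniq.
- by move=> x o; apply: gwf_mate.
Qed.

End Index.

(** * The chord index as a height difference *)

Section IndexHeight.

Lemma rightOf_leftOf (w R L : gword) (c : nat) (b : bool) : gwf w -> (c, true, b) \in w ->
  rot (overPos w c) w = (c, true, b) :: R ++ (c, false, b) :: L ->
  rightOf w c = R /\ leftOf w c = L.
Proof.
move=> Hw cw E; rewrite /rightOf /leftOf E.
have Hs : gwf ((c, true, b) :: R ++ (c, false, b) :: L).
  by apply: gwf_perm Hw; rewrite -E perm_sym perm_rot.
have -> : underPos ((c, true, b) :: R ++ (c, false, b) :: L) c = (size R).+1.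
  rewrite (@underPosE _ c b) ?inE ?mem_cat ?inE ?eqxx ?orbT //=.
  have := gwf_uniq Hs; rewrite /= cat_uniq /= => /and3P [_ _ /and3P [/norP [nR _] _ _]].
  by case: eqP => [[]|_] //; rewrite index_cat (negbTE nR) /= eqxx addn0.
rewrite /= drop0 take_size_cat //; split => //.
by rewrite -cat1s catA drop_size_cat // size_cat addn1.
Qed.

(** Once the word is rotated to start at the tail, [Ind] is the height of the stretch up to the
    head. The term [sg b] cancels the weight of the earlier of the two passages, which lies in only
    one of the two prefixes. *)
Lemma IndE (w : gword) (c : nat) (b : bool) : gwf w -> (c, true, b) \in w ->
  Ind w c = height (take (index (c, false, b) w) w)
            - height (take (index (c, true, b) w) w) + sg b.
Proof.
move=> Hw ow; have uw : (c, false, b) \in w by apply: (gwf_mate false Hw ow).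
have Uw := gwf_uniq Hw; have Zw := height_gwf Hw.
have Erot := rot_index ow; rewrite -(overPosE Hw ow) in Erot.
set zO := (c, true, b) in ow Erot *; set zU := (c, false, b) in uw *.
have main R L : rot (overPos w c) w = zO :: R ++ zU :: L -> Ind w c = height R.
  move=> E; have [ER EL] := rightOf_leftOf Hw ow E.
  have Hs : gwf (zO :: R ++ zU :: L).
    by apply: gwf_perm Hw; rewrite -E perm_sym perm_rot.
  have P : perm_eq (R ++ L ++ [:: zO; zU]) (zO :: R ++ zU :: L).
    by apply/permP => x; rewrite /= !count_cat /= ?count_cat /=; lia.
  have U : uniq (R ++ L ++ [:: zO; zU]) by rewrite (perm_uniq P); apply: gwf_uniq.
  have nc x : x \in R ++ L -> glab x != c.
    move=> xRL; apply/eqP => xc.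
    have xs : x \in zO :: R ++ zU :: L.
      by rewrite -(perm_mem P) catA mem_cat xRL.
    have xb : gpos x = b by apply: (gwf_sign Hs xs (_ : zO \in _) xc); rewrite inE eqxx.
    move: U; rewrite catA cat_uniq => /and3P [_ /hasPn D _].
    suff /D : x \in [:: zO; zU] by rewrite /= xRL.
    rewrite !inE; by rewrite [x]gletter_eta xc xb; case: (gover x); rewrite /zO /zU eqxx ?orbT.
  rewrite /Ind /r_ /l_ ER EL; apply: nchords_height.
    by move: U; rewrite catA cat_uniq => /andP [].
  move=> x o xRL; have xs : x \in zO :: R ++ zU :: L.
    by rewrite -(perm_mem P) catA mem_cat xRL.
  have := gwf_mate o Hs xs; rewrite -(perm_mem P) catA mem_cat => /orP [//|].
  by rewrite !inE /zO /zU !xpair_eqE (negbTE (nc _ xRL)).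
case: (ltngtP (index zO w) (index zU w)) => [lt|gt|E].
- have := cat_take_drop (index zU w) w; rewrite (drop_index uw).
  set t := take _ w; set L := drop _ w => Ew.
  have ot : zO \in t by rewrite /t in_take.
  have := cat_take_drop (index zO t) t; rewrite (drop_index ot).
  set l := take _ t; set R := drop _ t => Et.
  have Eo : index zO w = size l.
    by rewrite -Ew index_cat ot /l size_takel // index_size.
  have El : take (index zO w) w = l by rewrite Eo -Ew -Et -!catA take_size_cat.
  rewrite El -/t -Et height_cat height_cons (main R (L ++ l)).
    by rewrite /wt /zO /=; ring.
  by rewrite (overPosE Hw ow) Eo -{1}Ew -Et -catA rot_size_cat /= -catA.
- have := cat_take_drop (index zO w) w; rewrite (drop_index ow).
  set t := take _ w; set L := drop _ w => Ew.
  have ut : zU \in t by rewrite /t in_take.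
  have := cat_take_drop (index zU t) t; rewrite (drop_index ut).
  set l := take _ t; set R := drop _ t => Et.
  have Eu : index zU w = size l.
    by rewrite -Ew index_cat ut /l size_takel // index_size.
  have El : take (index zU w) w = l by rewrite Eu -Ew -Et -!catA take_size_cat.
  (* The stretch from tail to head wraps around the base point; since the total height is zero, its
     height is minus that of the stretch from head to tail. *)
  move: Zw; rewrite El -{1}Ew -Et !(height_cat, height_cons) (main (L ++ l) R).
    by rewrite height_cat /wt /zO /zU /= => Zw; apply/eqP; rewrite -subr_eq0 -Zw; apply/eqP; ring.
  have Eo : index zO w = size t by rewrite /t size_takel // index_size.
  by rewrite (overPosE Hw ow) Eo -{1}Ew rot_size_cat -Et /= -catA.
- by have := nth_index zO ow; rewrite E nth_index // /zO /zU => - [].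
Qed.

End IndexHeight.

(** * Walking along the diagram *)

Section Walk.

Variable X : Type.
Implicit Types (f : nat -> X) (st : int * X) (s t : gword) (F : option nat -> X).

(** A state is the height together with the colour of the current arc. The arc that starts at the
    under-passage of [c] has colour [f c], so an under-passage resets the colour. In [visits] each
    letter is paired with the state just before it. *)
Definition tr f st (y : gletter) : int * X :=
  (st.1 + wt y, if gover y then st.2 else f (glab y)).
Definition run f st s := foldl (tr f) st s.
Fixpoint visits f st s : seq (gletter * (int * X)) :=
  if s is y :: s' then (y, st) :: visits f (tr f st y) s' else [::].

Lemma run_cat f st s t : run f st (s ++ t) = run f (run f st s) t.
Proof. exact: foldl_cat. Qed.

Lemma visits_cat f st s t :
  visits f st (s ++ t) = visits f st s ++ visits f (run f st s) t.
Proof. by elim: s st => //= y s IH st; rewrite IH. Qed.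

Lemma run1 f st s : (run f st s).1 = st.1 + height s.
Proof.
elim: s st => [|y s IH] st /=; first by rewrite /height big_nil addr0.
by rewrite IH height_cons addrA.
Qed.

Lemma run2_over f st s : ~~ has (fun y => ~~ gover y) s -> (run f st s).2 = st.2.
Proof.
elim: s st => [//|z s IH] st /=; rewrite negb_or negbK => /andP [zo h].
by rewrite IH //= zo.
Qed.

(** The first under-passage erases the memory of the initial colour. *)
Lemma run2_under f st st' s : has (fun y => ~~ gover y) s ->
  (run f st s).2 = (run f st' s).2.
Proof.
elim: s st st' => [//|y s IH] st st' /=.
have [h _|h] := boolP (has (fun y => ~~ gover y) s); first exact: IH.
by rewrite orbF => yu; rewrite !run2_over //= (negbTE yu).
Qed.

Lemma eq_run f f' st s : {in s, forall y, f (glab y) = f' (glab y)} ->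
  run f st s = run f' st s.
Proof.
elim: s st => [//|y s IH] st /= E; rewrite /tr E ?inE ?eqxx //.
by apply: IH => z zs; apply: E; rewrite inE zs orbT.
Qed.

Lemma eq_visits f f' st s : {in s, forall y, f (glab y) = f' (glab y)} ->
  visits f st s = visits f' st s.
Proof.
elim: s st => [//|y s IH] st /= E; rewrite /tr E ?inE ?eqxx //.
by rewrite IH // => z zs; apply: E; rewrite inE zs orbT.
Qed.

Lemma visits_mem f st s z st' : List.In (z, st') (visits f st s) -> z \in s.
Proof.
elim: s st => [//|y s IH] st /= [[-> _]|/IH H]; rewrite inE ?eqxx //.
by rewrite H orbT.
Qed.

Lemma visits_index f st s z st' : uniq s ->
  List.In (z, st') (visits f st s) <->
  z \in s /\ st' = run f st (take (index z s) s).
Proof.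
elim: s st => [|y s IH] st /=; first by split => // -[].
case/andP => ys Us; rewrite inE eq_sym.
case: eqP => [<-|yz] /=.
  split => [[[<-]|/visits_mem] //|[_ ->]]; last by left.
  by rewrite (negbTE ys).
split => [[[]|/(IH _ Us)] //|/(IH _ Us)]; by right.
Qed.

Lemma lastUnder_rcons s y :
  lastUnder (rcons s y) = if gover y then lastUnder s else Some (glab y).
Proof.
rewrite /lastUnder filter_rcons; case: (gover y) => //=.
rewrite map_rcons; case: [seq _ | _ <- _] => //= a u.
by rewrite last_rcons.
Qed.

Lemma lastUnder_cat F h s t :
  F (lastUnder (s ++ t)) = (run (F \o Some) (h, F (lastUnder s)) t).2.
Proof.
elim/last_ind: t => [|t y IH]; first by rewrite cats0.
rewrite -rcons_cat lastUnder_rcons -cats1 run_cat [run _ _ [:: y]]/= /tr -IH.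
by case: (gover y).
Qed.

Lemma lastUnder_over s t : ~~ has (fun y => ~~ gover y) s ->
  lastUnder (s ++ t) = lastUnder t.
Proof.
by move=> h; rewrite /lastUnder filter_cat; move: h; rewrite has_filter negbK => /eqP ->.
Qed.

Definition start F (w : gword) : int * X := (0, F (lastUnder w)).

(** If the prefix contains an under-passage, the colour before it is irrelevant; otherwise position
    [p] is still on the arc through the base point, whose colour is the start colour. *)
Lemma arcAtE F w p : F (arcAt w p) = (run (F \o Some) (start F w) (take p w)).2.
Proof.
rewrite /arcAt /rot (lastUnder_cat _ 0).
have [h|h] := boolP (has (fun y => ~~ gover y) (take p w)); first exact: run2_under.
by rewrite !run2_over //= /start -[w in RHS](cat_take_drop p) lastUnder_over.
Qed.

Lemma run_closed F w : (run (F \o Some) (start F w) w).2 = F (lastUnder w).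
Proof.
have [h|h] := boolP (has (fun y => ~~ gover y) w); last by rewrite run2_over.
by rewrite (run2_under _ _ (0, F (lastUnder [::])) h) -lastUnder_cat.
Qed.

Lemma gwf_has_under w : gwf w -> w != [::] -> has (fun y => ~~ gover y) w.
Proof.
case: w => // y w Hw _; apply/hasP; exists (glab y, false, gpos y) => //.
by apply: gwf_mate; rewrite ?inE ?eqxx.
Qed.

(** A nonempty well-formed word has an under-passage, so the final colour does not depend on the
    assumed initial colour [a]. A walk that returns to [a] thus shows that [a] is the colour of the
    arc through the base point. *)
Lemma start_closed F a w : gwf w -> (w = [::] -> F None = a) ->
  (run (F \o Some) (0, a) w).2 = a -> F (lastUnder w) = a.
Proof.
move=> Hw H0 H; have [E|w0] := eqVneq w [::]; first by rewrite E H0.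
rewrite -[w in lastUnder w]cat0s (lastUnder_cat _ 0) -[RHS]H.
by apply: run2_under; apply: gwf_has_under.
Qed.

End Walk.

(** * Crossing relations in terms of local states *)

Section Relations.

Variables (X : Type) (op : int -> X -> X -> X).

(** Here [u] is the incoming and [v] the outgoing under-arc; the sign [b] decides which of them lies
    to the right of the over-arc [o]. *)
Definition rel_at (b : bool) (i : int) (o u v : X) : Prop :=
  if b then v = op i u o else u = op i v o.

(** The index is recovered from the heights at the two passages, as in [IndE]. *)
Definition crel b (o u : int * X) v := rel_at b (u.1 - o.1 + sg b) o.2 u.2 v.

(** The list may come from a part of a diagram: only crossings with both passages in it are
    constrained. *)
Definition good (f : nat -> X) (L : seq (gletter * (int * X))) : Prop :=
  forall c b o u, List.In ((c, true, b), o) L -> List.In ((c, false, b), u) L ->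
  crel b o u (f c).

Lemma iq_relsE w F : gwf w ->
  iq_rels w op F <-> good (F \o Some) (visits (F \o Some) (start F w) w).
Proof.
move=> Hw; have Uw := gwf_uniq Hw.
have E c b : (c, true, b) \in w ->
    (if csign w c
     then F (Some c) = op (Ind w c) (F (inArc w c)) (F (overArc w c))
     else F (inArc w c) = op (Ind w c) (F (Some c)) (F (overArc w c))) <->
    crel b (run (F \o Some) (start F w) (take (index (c, true, b) w) w))
           (run (F \o Some) (start F w) (take (index (c, false, b) w) w)) (F (Some c)).
  move=> cw; have uw : (c, false, b) \in w by apply: (gwf_mate false Hw cw).
  rewrite (csignE Hw cw) (IndE Hw cw) /inArc /overArc !arcAtE.
  rewrite (overPosE Hw cw) (underPosE Hw uw) /crel !run1 /= !add0r.
  by case: b cw uw.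
split=> [H c b o u|H c cw].
  move=> /(visits_index _ _ _ _ Uw) [ow ->] /(visits_index _ _ _ _ Uw) [_ ->].
  by apply/E => //; apply: H; apply: letter_labels ow.
have [b ow] := labels_letter Hw cw; have uw := gwf_mate false Hw ow.
by apply/(E _ _ ow); apply: H; apply/visits_index.
Qed.

End Relations.

(** * Colourings and transfer of presentations *)

Lemma isArc_arcAt w p : gwf w -> isArc w (arcAt w p).
Proof.
move=> Hw; rewrite /arcAt /lastUnder.
have sub c : c \in [seq glab x | x <- rot p w & ~~ gover x] -> c \in labels w.
  case/mapP => x; rewrite mem_filter mem_rot => /andP [_ xw] ->.
  by apply/labelsP; exists x.
case E: [seq _ | _ <- _] => [|c u] /=; last by apply: sub; rewrite E mem_last.
(* A nonempty well-formed word has an under-passage, so none of its positions lies on the arc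
   [None]. *)
apply: contraT => w0; have /hasP [x xw xu] := gwf_has_under Hw w0.
suff : glab x \in [seq glab x | x <- rot p w & ~~ gover x] by rewrite E.
by apply: map_f; rewrite mem_filter xu mem_rot.
Qed.

Lemma iq_rels_ext X (op : int -> X -> X -> X) w F F' : gwf w ->
  (forall a, isArc w a -> F a = F' a) -> iq_rels w op F -> iq_rels w op F'.
Proof.
move=> Hw E H c cw; rewrite -!E; try exact: isArc_arcAt; last exact: cw.
exact: H.
Qed.

Lemma iq_rels_hom X X' (op : int -> X -> X -> X) (op' : int -> X' -> X' -> X') h w F :
  iq_hom op op' h -> iq_rels w op F -> iq_rels w op' (h \o F).
Proof.
by move=> Hh H c /H; case: (csign w c) => /= ->; rewrite Hh.
Qed.

(* Colorings of a diagram are homomorphisms from its indexed quandle, so a   *)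
(* natural one-to-one correspondence of colorings turns a presentation of    *)
(* [w] on [Q] into a presentation of [w'] on the same [Q].                   *)
Definition coloring_map (w w' : gword)
    (C : forall X, (int -> X -> X -> X) -> (option nat -> X) -> (option nat -> X) -> Prop) :=
  [/\ forall X (op : int -> X -> X -> X) F, is_indexed_quandle op ->
        iq_rels w op F -> exists F', C X op F F',
      forall X (op : int -> X -> X -> X) F F', C X op F F' -> iq_rels w' op F' &
      forall X (op : int -> X -> X -> X) F1 F2 F1' F2', is_indexed_quandle op ->
        C X op F1 F1' -> C X op F2 F2' ->
        (forall a, isArc w a -> F1 a = F2 a) -> forall a, isArc w' a -> F1' a = F2' a].

Section Transfer.

Variable C : forall X, (int -> X -> X -> X) -> (option nat -> X) -> (option nat -> X) -> Prop.

Let C' X (op : int -> X -> X -> X) F F' := C op F' F.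

Definition natural_corr :=
  forall X X' (op : int -> X -> X -> X) (op' : int -> X' -> X' -> X') h F F',
  iq_hom op op' h -> C op F F' -> C op' (h \o F) (h \o F').

(** A colouring [f'] of [w'] is pulled back to [f] on [w], and [f] induces [h] with [h \o g = f] on
    arcs. Naturality makes [h \o g'] correspond to [h \o g], and since arc colours determine each
    other it equals [f']. Uniqueness of [h] is the same argument read backwards. *)
Lemma presents_transfer w w' : coloring_map w w' C -> coloring_map w' w C' -> natural_corr ->
  forall Q (op : int -> Q -> Q -> Q) g, presents_IndQ w op g ->
  exists g', presents_IndQ w' op g'.
Proof.
move=> [C1 C2 C3] [D1 D2 D3] N Q op g [Hop Hg Hu].
have [g' Cg] := C1 _ _ _ Hop Hg; exists g'; split=> //; first exact: C2 Cg.
move=> X opX f' HX Hf'; have [f Cf] := D1 _ _ _ HX Hf'.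
have [h [[hh hg] huniq]] := Hu X opX f HX (D2 _ _ _ _ Cf).
exists h; split=> [|h' [hh' hg']].
  by split=> // a aw'; apply: (C3 _ _ _ _ _ _ HX (N _ _ _ _ _ _ _ hh Cg) Cf hg _ aw').
apply: huniq; split=> // a aw.
exact: (D3 _ _ _ _ _ _ HX (N _ _ _ _ _ _ _ hh' Cg) Cf hg' _ aw).
Qed.

End Transfer.

Lemma presents_transfer_iff w w' C : coloring_map w w' C ->
  coloring_map w' w (fun X op F F' => C X op F' F) -> natural_corr C ->
  forall Q (op : int -> Q -> Q -> Q),
  (exists g, presents_IndQ w op g) <-> (exists g', presents_IndQ w' op g').
Proof.
move=> H H' N Q op; split=> -[g]; first exact: (presents_transfer H H' N).
by apply: (presents_transfer H' H) => X X' opX opX' h F F' hh; apply: N.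
Qed.

(** * Replacing a tangle inside a diagram *)

Section LocalMoves.

(* The letters that a move replaces, on three strands of the diagram; strands *)
(* not involved in the move are empty.                                        *)
Definition tangle := (gword * gword * gword)%type.
Implicit Types A B : tangle.

Definition letters A : gword := A.1.1 ++ A.1.2 ++ A.2.

Definition local_visits X (f : nat -> X) (s1 s2 s3 : int * X) A :=
  visits f s1 A.1.1 ++ visits f s2 A.1.2 ++ visits f s3 A.2.

(** Every colouring of [A] can be exchanged for one of [B] with the same incoming and outgoing
    states, so the outside cannot notice the replacement. *)
Definition local_sim A B : Prop :=
  forall X (op : int -> X -> X -> X), is_indexed_quandle op ->
  forall (s1 s2 s3 : int * X) f, good op f (local_visits f s1 s2 s3 A) ->
  exists f', [/\ good op f' (local_visits f' s1 s2 s3 B),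
    run f s1 A.1.1 = run f' s1 B.1.1,
    run f s2 A.1.2 = run f' s2 B.1.2 &
    run f s3 A.2 = run f' s3 B.2].

(** Incoming states leave no freedom inside the tangle; this makes the correspondence of colourings
    one-to-one. *)
Definition local_det A : Prop :=
  forall X (op : int -> X -> X -> X), is_indexed_quandle op ->
  forall (s1 s2 s3 : int * X) f f', good op f (local_visits f s1 s2 s3 A) ->
  good op f' (local_visits f' s1 s2 s3 A) ->
  {in letters A, forall y, f (glab y) = f' (glab y)}.

Variables u1 u2 u3 u4 : gword.

Definition plug A : gword := u1 ++ A.1.1 ++ u2 ++ A.1.2 ++ u3 ++ A.2 ++ u4.
Definition outer : gword := u1 ++ u2 ++ u3 ++ u4.

Definition fresh_outer A : Prop :=
  {in outer, forall y, glab y \notin [seq glab z | z <- letters A]}.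

(** Colourings correspond when they agree outside the tangle: same start, same colours of outer
    arcs, same state on leaving each strand. *)
Definition corr A B X (op : int -> X -> X -> X) (F F' : option nat -> X) : Prop :=
  let f := F \o Some in let f' := F' \o Some in let st := start F (plug A) in
  [/\ iq_rels (plug A) op F /\ iq_rels (plug B) op F',
      start F (plug A) = start F' (plug B),
      {in outer, forall y, f (glab y) = f' (glab y)} &
      [/\ run f st (u1 ++ A.1.1) = run f' st (u1 ++ B.1.1),
          run f st (u1 ++ A.1.1 ++ u2 ++ A.1.2) = run f' st (u1 ++ B.1.1 ++ u2 ++ B.1.2) &
          run f st (u1 ++ A.1.1 ++ u2 ++ A.1.2 ++ u3 ++ A.2)
            = run f' st (u1 ++ B.1.1 ++ u2 ++ B.1.2 ++ u3 ++ B.2)]].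

Lemma corr_sym A B X op (F F' : option nat -> X) :
  corr A B op F F' -> corr B A op F' F.
Proof.
case=> [[H1 H2] E H [E1 E2 E3]]; split=> //; first by move=> y /H.
by split; rewrite -E.
Qed.

Lemma run_hom X X' (h : X -> X') (f : nat -> X) st s :
  run (h \o f) (st.1, h st.2) s = ((run f st s).1, h (run f st s).2).
Proof.
elim: s st => [//|y s IH] st /=; rewrite -IH /tr /=.
by case: (gover y).
Qed.

Lemma corr_hom A B X X' (op : int -> X -> X -> X) (op' : int -> X' -> X' -> X') h F F' :
  iq_hom op op' h -> corr A B op F F' -> corr A B op' (h \o F) (h \o F').
Proof.
move=> hh [[H1 H2] E H [E1 E2 E3]].
have R s : run ((h \o F) \o Some) (start (h \o F) (plug A)) s =
  ((run (F \o Some) (start F (plug A)) s).1, h (run (F \o Some) (start F (plug A)) s).2).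
  by rewrite -run_hom.
have R' s : run ((h \o F') \o Some) (start (h \o F) (plug A)) s =
  ((run (F' \o Some) (start F (plug A)) s).1, h (run (F' \o Some) (start F (plug A)) s).2).
  by rewrite -run_hom.
split; first by split; apply: iq_rels_hom hh _.
- by case: E => E; rewrite /start /= E.
- by move=> y /H /= ->.
- by split; rewrite R R' ?E1 ?E2 ?E3.
Qed.

Lemma outer_cat (P : gletter -> Prop) : {in outer, forall y, P y} ->
  [/\ {in u1, forall y, P y}, {in u2, forall y, P y}, {in u3, forall y, P y}
    & {in u4, forall y, P y}].
Proof.
by move=> H; split=> y yu; apply: H; rewrite !mem_cat yu ?orbT.
Qed.

Lemma letters_cat A (P : gletter -> Prop) : {in letters A, forall y, P y} ->
  [/\ {in A.1.1, forall y, P y}, {in A.1.2, forall y, P y} & {in A.2, forall y, P y}].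
Proof.
by move=> H; split=> y yu; apply: H; rewrite !mem_cat yu ?orbT.
Qed.

Lemma good_sub X (op : int -> X -> X -> X) f L L' :
  (forall e, List.In e L' -> List.In e L) -> good op f L -> good op f L'.
Proof. by move=> S G c b o u /S oL /S uL; apply: G. Qed.

Lemma visits_plug X (f : nat -> X) st A :
  visits f st (plug A) =
    visits f st u1 ++ visits f (run f st u1) A.1.1
    ++ visits f (run f st (u1 ++ A.1.1)) u2
    ++ visits f (run f st (u1 ++ A.1.1 ++ u2)) A.1.2
    ++ visits f (run f st (u1 ++ A.1.1 ++ u2 ++ A.1.2)) u3
    ++ visits f (run f st (u1 ++ A.1.1 ++ u2 ++ A.1.2 ++ u3)) A.2
    ++ visits f (run f st (u1 ++ A.1.1 ++ u2 ++ A.1.2 ++ u3 ++ A.2)) u4.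
Proof. by rewrite /plug !visits_cat !run_cat. Qed.

Definition inner_visits X (f : nat -> X) st A :=
  local_visits f (run f st u1) (run f st (u1 ++ A.1.1 ++ u2))
    (run f st (u1 ++ A.1.1 ++ u2 ++ A.1.2 ++ u3)) A.

Lemma good_inner X op (f : nat -> X) st A :
  good op f (visits f st (plug A)) -> good op f (inner_visits f st A).
Proof.
apply: good_sub => e; rewrite visits_plug /inner_visits /local_visits.
rewrite !List.in_app_iff; tauto.
Qed.

(** Equal colourings of [plug A] give equal states on leaving each strand, hence equal states on
    entering the strands of [B]; [local_det] then settles the arcs inside [B]. *)
Lemma corr_det A B X op (F1 F2 F1' F2' : option nat -> X) :
  gwf (plug A) -> gwf (plug B) -> local_det B -> is_indexed_quandle op ->
  corr A B op F1 F1' -> corr A B op F2 F2' ->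
  (forall a, isArc (plug A) a -> F1 a = F2 a) ->
  forall a, isArc (plug B) a -> F1' a = F2' a.
Proof.
move=> HA HB D Hop [[_ G1] S1 O1 [P1 P2 _]] [[_ G2] S2 O2 [R1 R2 _]] E.
have ES : start F1 (plug A) = start F2 (plug A).
  by rewrite /start E // -[in lastUnder _](rot0 (plug A)) -/(arcAt _ 0) isArc_arcAt.
have EA : {in plug A, forall y, F1 (Some (glab y)) = F2 (Some (glab y))}.
  by move=> y yA; apply: E => /=; apply/labelsP; exists y.
have EO : {in outer, forall y, (F1' \o Some) (glab y) = (F2' \o Some) (glab y)}.
  move=> y yo; rewrite -O1 // -O2 //; apply: EA.
  by move: yo; rewrite !mem_cat => /or4P [] ->; rewrite ?orbT.
have [o1 o2 o3 o4] := outer_cat EO.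
have Q s : {subset s <= plug A} ->
    run (F1 \o Some) (start F1 (plug A)) s = run (F2 \o Some) (start F2 (plug A)) s.
  by move=> sub; rewrite ES; apply: eq_run => y /sub /EA.
have T1 : run (F1' \o Some) (start F1 (plug A)) (u1 ++ B.1.1)
          = run (F2' \o Some) (start F2 (plug A)) (u1 ++ B.1.1).
  rewrite -P1 -R1; apply: Q => y.
  by rewrite !mem_cat => /orP [] ->; rewrite ?orbT.
have T2 : run (F1' \o Some) (start F1 (plug A)) (u1 ++ B.1.1 ++ u2 ++ B.1.2)
          = run (F2' \o Some) (start F2 (plug A)) (u1 ++ B.1.1 ++ u2 ++ B.1.2).
  rewrite -P2 -R2; apply: Q => y.
  by rewrite !mem_cat => /or4P [] ->; rewrite ?orbT.
have EI : {in letters B, forall y, (F1' \o Some) (glab y) = (F2' \o Some) (glab y)}.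
  move: G1 => /(iq_relsE _ _ HB); rewrite -S1 => /good_inner G1.
  move: G2 => /(iq_relsE _ _ HB); rewrite -S2 => /good_inner G2.
  apply: (D _ _ Hop _ _ _ _ _ G1); move: G2; rewrite /inner_visits.
  rewrite !(catA u1) !run_cat; rewrite !run_cat in T1 T2.
  rewrite -ES -(eq_run _ o1) in T1 T2 *.
  by rewrite -T1 -(eq_run _ o2) in T2 *; rewrite -T2 -(eq_run _ o3).
case=> [c /labelsP [y yB ->]|].
  have : y \in outer ++ letters B.
    by move: yB; rewrite !mem_cat; do ?case/orP => [->|]; rewrite ?orbT // => ->; rewrite ?orbT.
  by rewrite mem_cat => /orP [/EO|/EI].
(* For an empty word the colour of the only arc [None] is the start colour. *)
move=> /= /eqP B0; move: ES; rewrite S1 S2 /start B0 => -[].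
by [].
Qed.

(** The colours supplied by [local_sim] inside are glued to the old ones outside. States agree on
    leaving each strand, so outer letters are visited in unchanged states, and freshness keeps every
    crossing wholly inside or wholly outside. *)
Lemma corr_sim A B X op (F : option nat -> X) :
  gwf (plug A) -> gwf (plug B) -> fresh_outer B -> local_sim A B ->
  is_indexed_quandle op -> iq_rels (plug A) op F -> exists F', corr A B op F F'.
Proof.
move=> HA HB fr S Hop HF; set f := F \o Some; set st := start F (plug A).
have G := (iq_relsE op F HA).1 HF; rewrite -/f -/st in G.
have [f0 [G0 E1 E2 E3]] := S _ _ Hop _ _ _ _ (good_inner G).
(* The arc [None] gets the start colour, which is needed when [plug B] is empty. *)
pose F' o := if o is Some c then
    if c \in [seq glab z | z <- letters B] then f0 c else f c else st.2.
pose f' := F' \o Some.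
have EO : {in outer, forall y, f (glab y) = f' (glab y)}.
  by move=> y /fr; rewrite /f' /F' /= => /negbTE ->.
have EI : {in letters B, forall y, f0 (glab y) = f' (glab y)}.
  by move=> y yB; rewrite /f' /F' /= map_f.
have [o1 o2 o3 o4] := outer_cat EO.
have [b1 b2 b3] := letters_cat EI.
have P1 : run f st (u1 ++ A.1.1) = run f' st (u1 ++ B.1.1).
  by rewrite !run_cat E1 -(eq_run _ o1) (eq_run _ b1).
have P1' : run f st (u1 ++ A.1.1 ++ u2) = run f' st (u1 ++ B.1.1 ++ u2).
  by rewrite !catA !(run_cat _ _ (u1 ++ _)) -P1 (eq_run _ o2).
have P2 : run f st (u1 ++ A.1.1 ++ u2 ++ A.1.2) = run f' st (u1 ++ B.1.1 ++ u2 ++ B.1.2).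
  move: E2 P1'; rewrite !catA !(run_cat _ _ (_ ++ u2)) => E2 P1'.
  by rewrite E2 -P1' (eq_run _ b2).
have P2' : run f st (u1 ++ A.1.1 ++ u2 ++ A.1.2 ++ u3)
           = run f' st (u1 ++ B.1.1 ++ u2 ++ B.1.2 ++ u3).
  move: P2; rewrite !catA !(run_cat _ _ (_ ++ A.1.2)) !(run_cat _ _ (_ ++ B.1.2)) => P2.
  by rewrite P2 (eq_run _ o3).
have P3 : run f st (u1 ++ A.1.1 ++ u2 ++ A.1.2 ++ u3 ++ A.2)
          = run f' st (u1 ++ B.1.1 ++ u2 ++ B.1.2 ++ u3 ++ B.2).
  move: E3 P2'; rewrite !catA !(run_cat _ _ (_ ++ u3)) => E3 P2'.
  by rewrite E3 -P2' (eq_run _ b3).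
have Pw : run f st (plug A) = run f' st (plug B).
  move: P3; rewrite /plug !catA !(run_cat _ _ (_ ++ A.2)) !(run_cat _ _ (_ ++ B.2)) => ->.
  by rewrite (eq_run _ o4).
have ES : st = start F' (plug B).
  rewrite /start (@start_closed _ F' st.2) //.
  by rewrite -[(0, st.2)]/st -Pw run_closed.
exists F'; split=> //; split=> //.
apply/iq_relsE => //; rewrite -ES -/f'.
pose VO := visits f st u1 ++ visits f (run f st (u1 ++ A.1.1)) u2
  ++ visits f (run f st (u1 ++ A.1.1 ++ u2 ++ A.1.2)) u3
  ++ visits f (run f st (u1 ++ A.1.1 ++ u2 ++ A.1.2 ++ u3 ++ A.2)) u4.
pose VI := inner_visits f' st B.
have GO : good op f VO.
  apply: good_sub G => e; rewrite visits_plug /VO !List.in_app_iff; tauto.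
have GI : good op f' VI.
  move=> c b o u oV uV.
  have EV : VI = local_visits f0 (run f st u1) (run f st (u1 ++ A.1.1 ++ u2))
                   (run f st (u1 ++ A.1.1 ++ u2 ++ A.1.2 ++ u3)) B.
    rewrite /VI /inner_visits /local_visits -(eq_run _ o1) -P1' -P2'.
    by rewrite -(eq_visits _ b1) -(eq_visits _ b2) -(eq_visits _ b3).
  have -> : f' c = f0 c.
    rewrite /f' /F' /= (_ : _ \in _ = true) //; apply/mapP; exists (c, true, b) => //.
    move: oV; rewrite /VI /inner_visits /local_visits !List.in_app_iff !mem_cat.
    by case=> [|[]] /visits_mem ->; rewrite ?orbT.
  by apply: G0; rewrite -EV.
have split_in e : List.In e (visits f' st (plug B)) -> List.In e VO \/ List.In e VI.
  rewrite visits_plug /VO /VI /inner_visits /local_visits -P1 -P2 -P3.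
  rewrite -(eq_visits _ o1) -(eq_visits _ o2) -(eq_visits _ o3) -(eq_visits _ o4).
  rewrite !List.in_app_iff; tauto.
have inO z s : List.In (z, s) VO -> z \in outer.
  rewrite /VO !List.in_app_iff !mem_cat.
  by case=> [|[|[]]] /visits_mem ->; rewrite ?orbT.
have inI z s : List.In (z, s) VI -> z \in letters B.
  rewrite /VI /inner_visits /local_visits !List.in_app_iff !mem_cat.
  by case=> [|[]] /visits_mem ->; rewrite ?orbT.
have sep z z' s s' : List.In (z, s) VO -> List.In (z', s') VI -> glab z <> glab z'.
  by move=> /inO /fr /negP nz /inI zB E; apply: nz; rewrite E map_f.
move=> c b o u /split_in [] oV /split_in [] uV.
- rewrite (_ : f' c = f c); first exact: GO.
  by rewrite -[c in RHS]/(glab (c, true, b)) EO //; apply: inO oV.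
- by have := sep _ _ _ _ oV uV.
- by have := sep _ _ _ _ uV oV.
- exact: GI.
Qed.

Lemma local_presents A B : gwf (plug A) -> gwf (plug B) ->
  fresh_outer A -> fresh_outer B ->
  local_sim A B -> local_sim B A -> local_det A -> local_det B ->
  forall Q (op : int -> Q -> Q -> Q),
  (exists g, presents_IndQ (plug A) op g) <-> (exists g, presents_IndQ (plug B) op g).
Proof.
move=> HA HB fA fB sAB sBA dA dB; apply: (presents_transfer_iff (C := corr A B)).
- split; first by move=> X op F Hop; apply: corr_sim.
    by move=> X op F F' [[]].
  by move=> X op F1 F2 F1' F2' Hop; apply: corr_det.
- split; last 1 first.
  + move=> X op F1 F2 F1' F2' Hop /corr_sym c1 /corr_sym c2.
    exact: corr_det HB HA dA Hop c1 c2.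
  + move=> X op F' Hop HF'; have [F /corr_sym H] := corr_sim HB HA fA sBA Hop HF'.
    by exists F.
  + by move=> X op F F' [[]].
- by move=> *; apply: corr_hom; eassumption.
Qed.

End LocalMoves.

(** An outer letter sharing a label with [A] would also share its sign, hence be a letter of [A],
    against the uniqueness of letters. *)
Lemma plug_fresh u1 u2 u3 u4 A : gwf (plug u1 u2 u3 u4 A) ->
  (forall y o, y \in letters A -> (glab y, o, gpos y) \in letters A) ->
  fresh_outer u1 u2 u3 u4 A.
Proof.
move=> Hw cl y yo; apply/mapP => -[z zA yz].
have P : perm_eq (plug u1 u2 u3 u4 A) (outer u1 u2 u3 u4 ++ letters A).
  by apply/permP => a; rewrite /plug /outer /letters !count_cat; lia.
have Hw' := gwf_perm P Hw; have := gwf_uniq Hw'.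
rewrite cat_uniq => /and3P [_ /hasPn D _].
have yw : y \in outer u1 u2 u3 u4 ++ letters A by rewrite mem_cat yo.
have zw : z \in outer u1 u2 u3 u4 ++ letters A by rewrite mem_cat zA orbT.
suff /D : y \in letters A by rewrite /= yo.
by rewrite [y]gletter_eta yz (gwf_sign Hw' yw zw yz) cl.
Qed.

(** * Identities in indexed quandles *)

Section QuandleAlgebra.

Variables (X : Type) (op : int -> X -> X -> X).
Hypothesis Hop : is_indexed_quandle op.

Lemma iq_idem a : op 0 a a = a.
Proof. by case: Hop. Qed.

Lemma iq_div i b c : exists a, c = op i a b.
Proof. by case: Hop => _ D _; have [a [<- _]] := D i b c; exists a. Qed.

Lemma iq_inj i b a a' : op i a b = op i a' b -> a = a'.
Proof.
case: Hop => _ D _ E; have [x [_ U]] := D i b (op i a' b).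
by rewrite -(U a E) -(U a' erefl).
Qed.

Lemma iq_dist i j k a b c : k = j - i ->
  op j (op i a b) c = op i (op j a c) (op k b c).
Proof. by move->; case: Hop. Qed.

Lemma rel_at_det b i o u v v' : rel_at op b i o u v -> rel_at op b i o u v' -> v = v'.
Proof. by case: b => /= [-> ->|-> /iq_inj]. Qed.

Lemma rel_at_index b i i' o u v : rel_at op b i o u v -> i = i' -> rel_at op b i' o u v.
Proof. by move=> H <-. Qed.

(* The incoming under-arc [m] lies on the right ([x = true]) of the over-arc *)
(* at a positive crossing and on its left ([x = false]) at a negative one.   *)
Definition side (b x : bool) (m m' : X) : X := if b == x then m else m'.

(* The third move: the bottom strand, which crosses the top arc [c] with     *)
(* sign [b1], meets the middle strand on one side of [c] before the move and *)
(* on the other side after it; [b1] tells which.                             *)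
Lemma slide_top_first b0 b1 b2 i j k c m m' a e d : k = j - i ->
  rel_at op b0 k c m m' -> rel_at op b1 j c a e ->
  rel_at op b2 i (side b0 (~~ b1) m m') e d ->
  exists e', rel_at op b2 i (side b0 b1 m m') a e' /\ rel_at op b1 j c e' d.
Proof.
move=> Hk H0.
(* Whatever the sign, the left part [L] of the middle strand is the right part [R] acted on by
   [c]. *)
have {H0} : side b0 false m m' = op k (side b0 true m m') c by case: b0 H0.
case: b1; rewrite [~~ _]/=;
  move: (side b0 false m m') (side b0 true m m') => L R HL /=.
  case: b2 => /= [-> ->|-> E].
    by exists (op i a R); rewrite (iq_dist _ _ _ Hk) HL.
  (* At a negative crossing with the middle strand the new colour comes from division;
     distributivity and cancellation of [L] give the other relation. *)
  have [e' Ea] := iq_div i R a; exists e'; split=> //.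
  by apply: (@iq_inj i L); rewrite -E Ea (iq_dist _ _ _ Hk) HL.
case: b2 => /= [-> ->|-> ->].
  by exists (op i (op j e c) L); rewrite (iq_dist _ _ _ Hk) HL.
by exists (op j d c); rewrite (iq_dist _ _ _ Hk) HL.
Qed.

(** This is the converse of [slide_top_first]: the bottom strand now meets the middle strand first
    and is moved to meet [c] first. *)
Lemma slide_middle_first b0 b1 b2 i j k c m m' a e d : k = j - i ->
  rel_at op b0 k c m m' -> rel_at op b1 j c e d ->
  rel_at op b2 i (side b0 b1 m m') a e ->
  exists e', rel_at op b1 j c a e' /\ rel_at op b2 i (side b0 (~~ b1) m m') e' d.
Proof.
move=> Hk H0.
have {H0} : side b0 false m m' = op k (side b0 true m m') c by case: b0 H0.
case: b1; rewrite [~~ _]/=;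
  move: (side b0 false m m') (side b0 true m m') => L R HL /= H H0.
  exists (op j a c); split=> //; move: H H0.
  by case: b2 => /= -> ->; rewrite (iq_dist _ _ _ Hk) HL.
have [x Ea] := iq_div j c a; exists x; split=> //; move: H0; rewrite Ea H.
case: b2 => /= E; apply: (@iq_inj j c).
  by rewrite E (iq_dist _ _ _ Hk) HL.
by rewrite E (iq_dist _ _ _ Hk) HL.
Qed.

End QuandleAlgebra.

(** * First move: curls *)

Definition trivial_tangle : tangle := ([::], [::], [::]).

Ltac in_visits := simpl; first [left; reflexivity | right; in_visits].
Ltac get_crel G c b H :=
  epose proof (G c b _ _ ltac:(in_visits) ltac:(in_visits)) as H;
  rewrite /crel /sg /= /wt /= in H.

Definition curl (o : bool) (x : nat) (s : bool) : tangle :=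
  ([::], [::], [:: (x, o, s); (x, ~~ o, s)]).

(** The passages are adjacent, so their heights give index [0]; idempotence and unique division then
    say that the strand keeps its colour. *)
Lemma curl_visits X (op : int -> X -> X -> X) f o x s s1 s2 s3 :
  is_indexed_quandle op ->
  good op f (local_visits f s1 s2 s3 (curl o x s)) <-> f x = s3.2.
Proof.
move=> Hop; split=> [G|E].
  case: o s G => -[] G; [get_crel G x true H|get_crel G x false H
    |get_crel G x true H|get_crel G x false H];
    move: H; (rewrite (_ : _ - _ + _ = 0); last by ring); rewrite ?iq_idem //.
  - by rewrite -{1}(iq_idem Hop s3.2) => /(iq_inj Hop).
  - by rewrite -{1}(iq_idem Hop (f x)) => /(iq_inj Hop).
move=> c b u v; case: o => /= [] [|[|//]] [] // -[<- <- <-] [|[|//]] [] // <-;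
  rewrite /crel /tr /= /wt /=;
  (rewrite (_ : _ - _ + _ = 0); last by rewrite /gpos /=; case: s; rewrite /sg; ring);
  by rewrite /glab /= !E /rel_at !iq_idem //; case: s.
Qed.

#[local] Arguments rel_at : simpl never.

Lemma curl_det o x s : local_det (curl o x s).
Proof.
move=> X op Hop s1 s2 s3 f f' /(curl_visits _ _ _ _ _ _ _ Hop) E.
move=> /(curl_visits _ _ _ _ _ _ _ Hop) E' y.
by rewrite !inE => /orP [] /eqP ->; rewrite /glab /= E E'.
Qed.

Lemma run_curl X (f : nat -> X) o x s st : f x = st.2 ->
  run f st [:: (x, o, s); (x, ~~ o, s)] = st.
Proof.
case: st => h a /= E; rewrite /tr /wt /=; case: o => /=; rewrite /glab /gpos /= E.
  by rewrite addrNK.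
by rewrite addrK.
Qed.

Lemma curl_sim o x s : local_sim trivial_tangle (curl o x s).
Proof.
move=> X op Hop s1 s2 s3 f _; exists (fun _ => s3.2).
by split=> //; [apply/curl_visits|rewrite run_curl].
Qed.

Lemma curl_sim_trivial o x s : local_sim (curl o x s) trivial_tangle.
Proof.
move=> X op Hop s1 s2 s3 f /(curl_visits _ _ _ _ _ _ _ Hop) E; exists f.
by split=> //; rewrite run_curl.
Qed.

(** * Second move: bigons *)

Definition bigon (sw : bool) (p q : nat) (e : bool) : tangle :=
  ([::],
   if sw then [:: (q, true, ~~ e); (p, true, e)] else [:: (p, true, e); (q, true, ~~ e)],
   [:: (p, false, e); (q, false, ~~ e)]).

(** Both crossings have the same index [i] and opposite signs, so the second undoes the first. The
    order [sw] in which the over-strand meets them only changes the value of [i]. *)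
Lemma bigon_visits X (op : int -> X -> X -> X) f sw (p q : nat) e (s1 s2 s3 : int * X) : p != q ->
  let i := s3.1 - s2.1 + (if sw then 0 else sg e) in
  good op f (local_visits f s1 s2 s3 (bigon sw p q e)) <->
  rel_at op e i s2.2 s3.2 (f p) /\ rel_at op (~~ e) i s2.2 (f p) (f q).
Proof.
move=> pq i; split=> [G|[H1 H2]].
  split; rewrite /i.
    case: sw e G @i => -[] G i;
    [get_crel G p true H|get_crel G p false H|get_crel G p true H|get_crel G p false H];
    by apply: (rel_at_index H); rewrite /sg; ring.
  case: sw e G @i => -[] G i;
    [get_crel G q false H|get_crel G q true H|get_crel G q false H|get_crel G q true H];
    by apply: (rel_at_index H); rewrite /sg; ring.
move=> c b u v.
have neq : p <> q by apply/eqP.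
case: sw @i H1 H2 => i H1 H2 /= [|[|[|[|//]]]] // [<- <- <-] [|[|[|[|//]]]] // [];
  try (by move/neq); try (by move/esym/neq); move=> *; subst; rewrite /crel /=.
all: rewrite /tr /= /glab /=.
all: try (apply: (rel_at_index H1)); try (apply: (rel_at_index H2)).
all: rewrite /i /wt /gpos /sg /=; case: (e) => /=; ring.
Qed.

Lemma run_bigon_under X (f : nat -> X) (p q : nat) e st : f q = st.2 ->
  run f st [:: (p, false, e); (q, false, ~~ e)] = st.
Proof.
case: st => h a /= E; rewrite /tr /wt /sg /= /glab /gpos /= E.
by congr (_, _); case: e => /=; ring.
Qed.

Lemma run_bigon_over X (f : nat -> X) sw (p q : nat) e st :
  run f st (if sw then [:: (q, true, ~~ e); (p, true, e)] else [:: (p, true, e); (q, true, ~~ e)])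
  = st.
Proof.
case: st => h a; case: sw; rewrite /= /tr /wt /sg /= /gpos /=;
  by congr (_, _); case: e => /=; ring.
Qed.

Lemma bigon_closes X (op : int -> X -> X -> X) e i o a m d : is_indexed_quandle op ->
  rel_at op e i o a m -> rel_at op (~~ e) i o m d -> d = a.
Proof.
move=> Hop; rewrite /rel_at; case: e => /= [->|-> -> //].
by move/(iq_inj Hop).
Qed.

Lemma bigon_opens X (op : int -> X -> X -> X) e i o a : is_indexed_quandle op ->
  exists m, rel_at op e i o a m /\ rel_at op (~~ e) i o m a.
Proof.
move=> Hop; rewrite /rel_at; case: e => /=; first by exists (op i a o).
by have [m E] := iq_div Hop i o a; exists m.
Qed.

Lemma bigon_det sw (p q : nat) e : p != q -> local_det (bigon sw p q e).
Proof.
move=> pq X op Hop s1 s2 s3 f f' /(bigon_visits _ _ _ _ _ _ _ pq) [H1 H2].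
move=> /(bigon_visits _ _ _ _ _ _ _ pq) [H1' H2'] y yB.
have Ep := rel_at_det Hop H1 H1'.
have Eq : f q = f' q by rewrite (bigon_closes Hop H1 H2) (bigon_closes Hop H1' H2').
suff : (glab y == p) || (glab y == q) by case/orP => /eqP ->.
by move: yB; rewrite /letters /=; case: (sw); rewrite !inE => /or4P [] /eqP ->;
  rewrite /glab /= eqxx ?orbT.
Qed.

Lemma bigon_sim sw (p q : nat) e : p != q -> local_sim trivial_tangle (bigon sw p q e).
Proof.
move=> pq X op Hop s1 s2 s3 f _.
have [m [H1 H2]] := bigon_opens e (s3.1 - s2.1 + (if sw then 0 else sg e)) s2.2 s3.2 Hop.
(* The arc between the crossings gets [m]; after [q] the strand recovers its incoming colour. *)
exists (fun c => if c == p then m else s3.2); split=> //.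
- apply/bigon_visits => //; by rewrite eqxx eq_sym (negbTE pq).
- by rewrite run_bigon_over.
- by rewrite run_bigon_under // eq_sym (negbTE pq).
Qed.

Lemma bigon_sim_trivial sw (p q : nat) e : p != q ->
  local_sim (bigon sw p q e) trivial_tangle.
Proof.
move=> pq X op Hop s1 s2 s3 f /(bigon_visits _ _ _ _ _ _ _ pq) [H1 H2].
exists f; split=> //; first by rewrite run_bigon_over.
by rewrite run_bigon_under // (bigon_closes Hop H1 H2).
Qed.

(** * Third move: triangles *)

Section Triangle.

Variable X : Type.
Implicit Types (op : int -> X -> X -> X) (st : int * X).

Definition pass (o b : bool) (v : X) st : int * X :=
  (st.1 + (if o then - sg b else sg b), if o then st.2 else v).

(** The states of a strand at the first and second of its two crossings in label order; [o], [b],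
    [v] describe the other crossing, which has been passed already or not according to the
    orientation [s]. *)
Definition first_state (s o b : bool) v st := if s then st else pass o b v st.
Definition second_state (s o b : bool) v st := if s then pass o b v st else st.
Definition end_state (s o1 b1 : bool) v1 o2 b2 v2 st :=
  if s then pass o2 b2 v2 (pass o1 b1 v1 st) else pass o1 b1 v1 (pass o2 b2 v2 st).

Definition crossing op (h b : bool) (st st' : int * X) v :=
  if h then crel op b st st' v else crel op b st' st v.

Definition tri_good op (s1 s2 s3 t h12 h13 h23 : bool) (a b c : int * X) (vp vq vr : X) :=
  let g12 := tsign h12 s1 s2 t in
  let g13 := tsign h13 s1 s3 t in
  let g23 := tsign h23 s2 s3 t in
  [/\ crossing op h12 g12 (first_state s1 h13 g13 vq a) (first_state s2 h23 g23 vr b) vp,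
      crossing op h13 g13 (second_state s1 h12 g12 vp a) (first_state s3 (~~ h23) g23 vr c) vq &
      crossing op h23 g23 (second_state s2 (~~ h12) g12 vp b)
        (second_state s3 (~~ h13) g13 vq c) vr].

Definition tri_end (s1 s2 s3 t h12 h13 h23 : bool) (a b c : int * X) (vp vq vr : X) :=
  let g12 := tsign h12 s1 s2 t in
  let g13 := tsign h13 s1 s3 t in
  let g23 := tsign h23 s2 s3 t in
  (end_state s1 h12 g12 vp h13 g13 vq a, end_state s2 (~~ h12) g12 vp h23 g23 vr b,
   end_state s3 (~~ h13) g13 vq (~~ h23) g23 vr c).

Lemma tri_run (f : nat -> X) p q r s1 s2 s3 t h12 h13 h23 a b c :
  let T := tri_segs p q r s1 s2 s3 t h12 h13 h23 in
  (run f a T.1.1, run f b T.1.2, run f c T.2)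
  = tri_end s1 s2 s3 t h12 h13 h23 a b c (f p) (f q) (f r).
Proof. by case: s1; case: s2; case: s3. Qed.

Lemma tri_visits op f (p q r : nat) s1 s2 s3 t h12 h13 h23 (a b c : int * X) :
  p != q -> p != r -> q != r ->
  good op f (local_visits f a b c (tri_segs p q r s1 s2 s3 t h12 h13 h23)) <->
  tri_good op s1 s2 s3 t h12 h13 h23 a b c (f p) (f q) (f r).
Proof.
move=> pq pr qr; rewrite /tri_good /crossing /tri_segs.
move: (tsign h12 s1 s2 t) (tsign h13 s1 s3 t) (tsign h23 s2 s3 t) => g12 g13 g23.
split=> [G|[Hp Hq Hr] l g u v].
  split.
  - by case: s1 s2 h12 G => [] [] [] G; apply: G; in_visits.
  - by case: s1 s2 s3 h13 G => [] [] [] [] G; apply: G; in_visits.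
  - by case: s1 s2 s3 h23 G => [] [] [] [] G; apply: G; in_visits.
have npq : p <> q by apply/eqP.
have npr : p <> r by apply/eqP.
have nqr : q <> r by apply/eqP.
case: s1 s2 s3 Hp Hq Hr => [] [] [] Hp Hq Hr /=;
  case=> [|[|[|[|[|[|//]]]]]] [??? Eu]; case=> [|[|[|[|[|[|//]]]]]] [??? Ev];
  subst; try congruence; done.
Qed.

End Triangle.

Ltac close_tri H0 H1 H2 :=
  split; [split; rewrite /crossing /crel /pass /sg /=;
    (eapply rel_at_index; [first [exact H0 | exact H1 | exact H2] | ring])
  | rewrite /tri_end /end_state /pass /=; do !(congr (_, _)); ring].

(** The equation left to [ring] is the additivity of indices around the triangle. *)
Ltac use_slide P e H1 H2 :=
  lazymatch type of P with ?A -> _ =>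
    let E := fresh in assert (E : A) by ring; destruct (P E) as [e [H1 H2]]
  end.

(** The relations [H0], [Hj], [Hi] belong to the top-middle, top-bottom and middle-bottom crossings.
    Both directions of the slide are tried, and [k] puts the new colours in the order of [p], [q],
    [r]. The colour at the top-middle crossing does not change. *)
Ltac slide_tri Hop H0 Hj Hi k :=
  let P := fresh in let e := fresh in let H1 := fresh in let H2 := fresh in
  lazymatch type of H0 with rel_at _ _ _ _ _ ?m =>
    first
    [ lazymatch type of Hi with rel_at _ _ _ _ _ ?d =>
        pose proof (fun E => slide_top_first Hop E H0 Hj Hi) as P;
        use_slide P e H1 H2; k m d e; close_tri H0 H1 H2 end
    | lazymatch type of Hj with rel_at _ _ _ _ _ ?d =>
        pose proof (fun E => slide_middle_first Hop E H0 Hj Hi) as P;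
        use_slide P e H1 H2; k m e d; close_tri H0 H1 H2 end ]
  end.

Lemma tri_slide X (op : int -> X -> X -> X) s1 s2 s3 t h12 h13 h23 a b c vp vq vr :
  is_indexed_quandle op -> acyclic3 h12 h13 h23 ->
  tri_good op s1 s2 s3 t h12 h13 h23 a b c vp vq vr ->
  exists vp' vq' vr',
    tri_good op (~~ s1) (~~ s2) (~~ s3) t h12 h13 h23 a b c vp' vq' vr' /\
    tri_end s1 s2 s3 t h12 h13 h23 a b c vp vq vr
    = tri_end (~~ s1) (~~ s2) (~~ s3) t h12 h13 h23 a b c vp' vq' vr'.
Proof.
move=> Hop; case: a b c => [ha a] [hb b] [hc c].
case: h12 h13 h23 => [] [] [] // _; case: s1 s2 s3 t => [] [] [] [] [];
  rewrite /crossing /crel /sg /= => Hp Hq Hr.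
(* The six attempts are the assignments of the three roles to the crossings, one for each height
   order. *)
all: first
  [ slide_tri Hop Hp Hq Hr ltac:(fun x y z => exists x, y, z)
  | slide_tri Hop Hp Hr Hq ltac:(fun x y z => exists x, z, y)
  | slide_tri Hop Hq Hp Hr ltac:(fun x y z => exists y, x, z)
  | slide_tri Hop Hq Hr Hp ltac:(fun x y z => exists z, x, y)
  | slide_tri Hop Hr Hp Hq ltac:(fun x y z => exists y, z, x)
  | slide_tri Hop Hr Hq Hp ltac:(fun x y z => exists z, y, x) ].
Qed.

(** The relations are solved from the top: the top strand keeps its colour, which fixes the middle
    strand, and the bottom strand follows crossing by crossing. *)
Lemma tri_good_det X (op : int -> X -> X -> X) s1 s2 s3 t h12 h13 h23 a b c vp vq vr vp' vq' vr' :
  is_indexed_quandle op -> acyclic3 h12 h13 h23 ->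
  tri_good op s1 s2 s3 t h12 h13 h23 a b c vp vq vr ->
  tri_good op s1 s2 s3 t h12 h13 h23 a b c vp' vq' vr' ->
  [/\ vp = vp', vq = vq' & vr = vr'].
Proof.
move=> Hop; rewrite /tri_good.
move: (tsign h12 s1 s2 t) (tsign h13 s1 s3 t) (tsign h23 s2 s3 t) => g12 g13 g23.
case: h12 h13 h23 => [] [] [] // _; case: s1 s2 s3 => [] [] [];
  rewrite /crossing /crel /= => - [Hp Hq Hr] [Hp' Hq' Hr'].
all: repeat match goal with
  | H : rel_at _ ?g ?i ?o ?u ?v, H' : rel_at _ ?g ?i ?o ?u ?v' |- _ =>
    have ? := rel_at_det Hop H H'; subst; clear H H'
  end; by [].
Qed.

Definition rev_tangle (T : tangle) : tangle := (rev T.1.1, rev T.1.2, rev T.2).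

(** Each sign involves two strand orientations, so reversing all three strands preserves it. *)
Lemma tri_segs_rev p q r s1 s2 s3 t h12 h13 h23 :
  rev_tangle (tri_segs p q r s1 s2 s3 t h12 h13 h23)
  = tri_segs p q r (~~ s1) (~~ s2) (~~ s3) t h12 h13 h23.
Proof. by case: s1 s2 s3 t h12 h13 h23 => [] [] [] [] [] [] []. Qed.

Section TriangleMove.

Variables p q r : nat.
Hypotheses (pq : p != q) (pr : p != r) (qr : q != r).

Lemma tri_sim s1 s2 s3 t h12 h13 h23 : acyclic3 h12 h13 h23 ->
  local_sim (tri_segs p q r s1 s2 s3 t h12 h13 h23)
            (tri_segs p q r (~~ s1) (~~ s2) (~~ s3) t h12 h13 h23).
Proof.
move=> Hh X op Hop a b c f /(tri_visits _ _ _ _ _ _ _ _ _ _ _ _ pq pr qr) G.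
have [vp [vq [vr [G' E]]]] := tri_slide Hop Hh G.
pose f' l := if l == p then vp else if l == q then vq else vr.
have Ep : f' p = vp by rewrite /f' eqxx.
have Eq : f' q = vq by rewrite /f' eqxx eq_sym (negbTE pq).
have Er : f' r = vr by rewrite /f' !(eq_sym r) (negbTE pr) (negbTE qr).
rewrite -Ep -Eq -Er in G' E.
exists f'; move: E; rewrite -!tri_run => -[E1 E2 E3]; split=> //.
exact/tri_visits.
Qed.

Lemma tri_det s1 s2 s3 t h12 h13 h23 : acyclic3 h12 h13 h23 ->
  local_det (tri_segs p q r s1 s2 s3 t h12 h13 h23).
Proof.
move=> Hh X op Hop a b c f f' /(tri_visits _ _ _ _ _ _ _ _ _ _ _ _ pq pr qr) G.
move=> /(tri_visits _ _ _ _ _ _ _ _ _ _ _ _ pq pr qr) G' y yT.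
have [Ep Eq Er] := tri_good_det Hop Hh G G'.
suff : [|| glab y == p, glab y == q | glab y == r] by case/or3P => /eqP ->.
move: yT; rewrite /letters; case: (s1); case: (s2); case: (s3); rewrite /= !inE;
  by do ?case/orP; move/eqP->; rewrite /glab /= eqxx ?orbT.
Qed.

End TriangleMove.

Lemma tri_letters_mate p q r s1 s2 s3 t h12 h13 h23 y o :
  let T : tangle := tri_segs p q r s1 s2 s3 t h12 h13 h23 in
  y \in letters T -> (glab y, o, gpos y) \in letters T.
Proof.
rewrite /tri_segs.
move: (tsign h12 s1 s2 t) (tsign h13 s1 s3 t) (tsign h23 s2 s3 t) => g12 g13 g23.
case: s1 s2 s3 => [] [] []; rewrite /letters /= !inE;
  do ?case/orP; move/eqP->; rewrite /glab /gpos /=;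
  by case: o; case: h12; case: h13; case: h23; rewrite /= !eqxx ?orbT.
Qed.

(** * Change of base point *)

Lemma gwf_rot n w : gwf (rot n w) <-> gwf w.
Proof. by split; apply: gwf_perm; rewrite ?perm_rot // perm_sym perm_rot. Qed.

(** As [x] occurs only once, the cyclic word has just one rotation starting with [x]. *)
Lemma rot_index_rot n w (x : gletter) : uniq w -> x \in w ->
  rot (index x (rot n w)) (rot n w) = rot (index x w) w.
Proof.
move=> U xw.
have [k kw E] : exists2 k, (k <= size w)%N & rot (index x (rot n w)) (rot n w) = rot k w.
  by exists (rot_add w n (index x (rot n w))); [apply: leq_rot_add|apply: rot_rot_add].
have H : head x (rot k w) = x by rewrite -E rot_index ?mem_rot.
(* The bound on [k] is not strict: for [k = size w] the rotation is the identity and [x] is the head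
   of [w]. *)
rewrite E; move: kw; rewrite leq_eqVlt => /orP [/eqP ek|lt].
  move: H; rewrite ek rot_size; case: w U xw {E ek} => //= y w U _ ->.
  by rewrite eqxx rot0.
suff -> : index x w = k by [].
by rewrite -[in LHS]H -nth0 /rot nth_cat size_drop subn_gt0 lt nth_drop addn0 index_uniq.
Qed.

Lemma presents_eq w w' :
  (forall X (op : int -> X -> X -> X) g, iq_rels w op g <-> iq_rels w' op g) ->
  isArc w =1 isArc w' ->
  forall Q (op : int -> Q -> Q -> Q) g, presents_IndQ w op g -> presents_IndQ w' op g.
Proof.
move=> R A Q op g [H1 H2 H3]; split=> //; first exact/R.
move=> X opX f HX /R Hf; have [h [[hh hg] hu]] := H3 X opX f HX Hf.
exists h; split=> [|h' [hh' hg']]; first by split=> // a; rewrite -A => /hg.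
by apply: hu; split=> // a; rewrite A => /hg'.
Qed.

(** Index and arcs at [c] depend only on the rotations of the word that start at a passage of
    [c]. *)
Lemma iq_rels_rot n w X (op : int -> X -> X -> X) g : gwf w ->
  iq_rels w op g <-> iq_rels (rot n w) op g.
Proof.
move=> Hw; have Hr := (gwf_rot n w).2 Hw; have U := gwf_uniq Hw.
have E c b : (c, true, b) \in w ->
  [/\ csign (rot n w) c = csign w c, Ind (rot n w) c = Ind w c,
      inArc (rot n w) c = inArc w c & overArc (rot n w) c = overArc w c].
  move=> ow; have uw : (c, false, b) \in w by apply: (gwf_mate false Hw ow).
  have or : (c, true, b) \in rot n w by rewrite mem_rot.
  have ur : (c, false, b) \in rot n w by rewrite mem_rot.
  rewrite (csignE Hw ow) (csignE Hr or); split=> //.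
  - rewrite /Ind /r_ /l_ /leftOf /rightOf (overPosE Hw ow) (overPosE Hr or).
    by rewrite rot_index_rot.
  - by rewrite /inArc (underPosE Hw uw) (underPosE Hr ur) /arcAt rot_index_rot.
  - by rewrite /overArc (overPosE Hw ow) (overPosE Hr or) /arcAt rot_index_rot.
have L c : (c \in labels (rot n w)) = (c \in labels w).
  by apply/labelsP/labelsP => -[x xw ->]; exists x; rewrite ?mem_rot // -(mem_rot n).
split=> H c; [rewrite L|rewrite -L] => cw; have := H c cw;
  rewrite ?L in cw; have [b ow] := labels_letter Hw cw;
  by have [-> -> -> ->] := E c b ow.
Qed.

Lemma isArc_rot n w : isArc (rot n w) =1 isArc w.
Proof.
case=> [c|] /=; last by rewrite -!size_eq0 size_rot.
by apply/labelsP/labelsP => -[x xw ->]; exists x; rewrite ?mem_rot // -(mem_rot n).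
Qed.

(** * Renaming of crossings *)

Section Relabelling.

Variable f : nat -> nat.
Hypothesis f_inj : injective f.

Lemma relab_inj : injective (relab f).
Proof.
move=> [[c o] b] [[c' o'] b'] [/f_inj E1 E2 E3].
by rewrite (E1 : c = c') (E2 : o = o') (E3 : b = b').
Qed.

Lemma gwf_relab w : gwf (map (relab f) w) <-> gwf w.
Proof.
have C x : count (fun y => glab y == glab (relab f x)) (map (relab f) w)
           = count (fun y => glab y == glab x) w.
  by rewrite count_map; apply: eq_count => y /=; rewrite /glab /= (inj_eq f_inj).
have M x o : count_mem (glab (relab f x), o, gpos (relab f x)) (map (relab f) w)
           = count_mem (glab x, o, gpos x) w.
  rewrite count_map; apply: eq_count => y /=.
  by rewrite -(inj_eq relab_inj y).
split=> H x.
  move=> xw; have := H (relab f x); rewrite (mem_map relab_inj) => /(_ xw).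
  by rewrite C !M.
by case/mapP => y /H; rewrite -C -!M => ? ->.
Qed.

Lemma find_relab w c (P : gletter -> bool) : (forall x, P (relab f x) = P x) ->
  find (fun x => (glab x == f c) && P x) (map (relab f) w)
  = find (fun x => (glab x == c) && P x) w.
Proof.
move=> HP; rewrite find_map; apply: eq_find => x /=.
by rewrite HP /glab /= (inj_eq f_inj).
Qed.

Lemma overPos_relab w c : overPos (map (relab f) w) (f c) = overPos w c.
Proof. exact: find_relab. Qed.

Lemma underPos_relab w c : underPos (map (relab f) w) (f c) = underPos w c.
Proof. exact: find_relab. Qed.

Lemma lastUnder_relab w : lastUnder (map (relab f) w) = omap f (lastUnder w).
Proof.
elim/last_ind: w => [//|w y IH].
rewrite map_rcons !lastUnder_rcons IH -[gover (relab f y)]/(gover y).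
by case: (gover y).
Qed.

Lemma arcAt_relab w p : arcAt (map (relab f) w) p = omap f (arcAt w p).
Proof. by rewrite /arcAt -map_rot lastUnder_relab. Qed.

Lemma nchords_relab A B b :
  nchords (map (relab f) A) (map (relab f) B) b = nchords A B b.
Proof.
rewrite /nchords count_map; apply: eq_count => x /=.
by rewrite -[(glab (relab f x), false, _)]/(relab f (glab x, false, gpos x))
  (mem_map relab_inj).
Qed.

Lemma Ind_relab w c : Ind (map (relab f) w) (f c) = Ind w c.
Proof.
rewrite /Ind /r_ /l_ /leftOf /rightOf overPos_relab -map_rot underPos_relab.
by rewrite -!map_drop -map_take !nchords_relab.
Qed.

Lemma labels_relab w c : (f c \in labels (map (relab f) w)) = (c \in labels w).
Proof.
apply/labelsP/labelsP => [[x /mapP [y yw ->] /f_inj ->]|[x xw ->]].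
  by exists y.
by exists (relab f x); rewrite // map_f.
Qed.

Lemma labels_relabP w d : d \in labels (map (relab f) w) ->
  exists2 c, c \in labels w & d = f c.
Proof.
case/labelsP => x /mapP [y yw ->] ->; exists (glab y) => //.
by apply/labelsP; exists y.
Qed.

Lemma csign_relab w c : gwf w -> c \in labels w ->
  csign (map (relab f) w) (f c) = csign w c.
Proof.
move=> Hw cw; have [b ow] := labels_letter Hw cw; rewrite (csignE Hw ow).
by apply: csignE; [apply/gwf_relab|apply: (map_f (relab f) ow)].
Qed.

Lemma iq_rels_relab w X (op : int -> X -> X -> X) g : gwf w ->
  iq_rels (map (relab f) w) op g <-> iq_rels w op (g \o omap f).
Proof.
move=> Hw.
have E c : (inArc (map (relab f) w) (f c) = omap f (inArc w c)) *
           (overArc (map (relab f) w) (f c) = omap f (overArc w c)).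
  by rewrite /inArc /overArc overPos_relab underPos_relab !arcAt_relab.
split=> H c.
  by move=> cw; have := H (f c); rewrite labels_relab cw csign_relab // Ind_relab !E; apply.
case/labels_relabP => d dw ->; rewrite csign_relab // Ind_relab !E.
exact: H.
Qed.

Lemma presents_relab w Q (op : int -> Q -> Q -> Q) : gwf w ->
  (exists g, presents_IndQ w op g) <-> (exists g, presents_IndQ (map (relab f) w) op g).
Proof.
move=> Hw.
apply: (presents_transfer_iff (C := fun X op F F' =>
  [/\ iq_rels w op F, iq_rels (map (relab f) w) op F' &
      forall a, isArc w a -> F a = F' (omap f a)])).
- split; last 1 first.
  + move=> X opX F1 F2 F1' F2' _ [_ _ E1] [_ _ E2] E [d /labels_relabP [c cw ->]|].
      have ca : isArc w (Some c) by [].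
      by rewrite -[Some (f c)]/(omap f (Some c)) -E1 // -E2 // E.
    move=> /eqP w0; have {w0} w0 : isArc w None by case: (w) w0.
    by rewrite -[None]/(omap f None) -E1 // -E2 // E.
  + move=> X opX F _ HF.
    (* Since [f] need not be surjective, it is inverted by lookup among the labels of [w]; values at
       other labels do not matter. *)
    pose F' o := if o is Some d then
      F (Some (nth 0%N (labels w) (index d (map f (labels w))))) else F None.
    have E a : isArc w a -> F a = F' (omap f a).
      case: a => [c /= cw|//]; rewrite /= index_map // nth_index //.
    exists F'; split=> //; apply/iq_rels_relab => //.
    by apply: iq_rels_ext HF.
  + by move=> X opX F F' [].
- split; last 1 first.
  + move=> X opX F1 F2 F1' F2' _ [_ _ E1] [_ _ E2] E a aw; rewrite E1 // E2 //.
    apply: E; case: a aw => [c /= cw|/= /eqP -> //].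
    by rewrite labels_relab.
  + move=> X opX F' _ HF'; exists (F' \o omap f); split=> //.
    exact/iq_rels_relab.
  + by move=> X opX F F' [].
- move=> X X' opX opX' h F F' hh [H1 H2 E]; split; try exact: iq_rels_hom hh _.
  by move=> a /E /= ->.
Qed.

End Relabelling.

(** * Presentations under each move *)

Lemma presents_rot n w Q (op : int -> Q -> Q -> Q) : gwf w ->
  (exists g, presents_IndQ w op g) <-> (exists g, presents_IndQ (rot n w) op g).
Proof.
move=> Hw; split=> -[g H]; exists g.
  by apply: presents_eq H => [X opX F|a]; [apply: iq_rels_rot|rewrite isArc_rot].
by apply: presents_eq H => [X opX F|a]; [apply: iff_sym; apply: iq_rels_rot|rewrite isArc_rot].
Qed.

Lemma presents_curl u v x o s : gwf (u ++ v) ->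
  gwf (u ++ [:: (x, o, s); (x, ~~ o, s)] ++ v) ->
  forall Q (op : int -> Q -> Q -> Q),
  (exists g, presents_IndQ (u ++ v) op g) <->
  (exists g, presents_IndQ (u ++ [:: (x, o, s); (x, ~~ o, s)] ++ v) op g).
Proof.
move=> H H'.
have fr : fresh_outer [::] [::] u v (curl o x s).
  apply: plug_fresh => // y o'; rewrite /letters /= !inE => /orP [] /eqP ->;
    by rewrite /glab /gpos /=; case: o o' {H'} => [] []; rewrite eqxx ?orbT.
apply: (local_presents (u1 := [::]) (u2 := [::]) (A := trivial_tangle) (B := curl o x s)) => //.
- exact: curl_sim.
- exact: curl_sim_trivial.
- exact: curl_det.
Qed.

Lemma presents_bigon u1 u2 u3 sw p q e :
  let B := bigon sw p q e in
  gwf (u1 ++ u2 ++ u3) -> gwf (u1 ++ B.1.2 ++ u2 ++ B.2 ++ u3) ->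
  forall Q (op : int -> Q -> Q -> Q),
  (exists g, presents_IndQ (u1 ++ u2 ++ u3) op g) <->
  (exists g, presents_IndQ (u1 ++ B.1.2 ++ u2 ++ B.2 ++ u3) op g).
Proof.
move=> B H H'.
(* If [p] and [q] coincided, their label would occur four times. *)
have pq : p != q.
  have [Hc _ _] := H' (p, false, e) ltac:(rewrite !mem_cat inE eqxx ?orbT //).
  apply/eqP => E; move: Hc; rewrite /B -E !count_cat /=.
  by case: (sw); rewrite /= /glab /= eqxx; lia.
have fr : fresh_outer [::] u1 u2 u3 B.
  apply: plug_fresh => // y o; rewrite /letters /B /=.
  by case: (sw); rewrite !inE => /or4P [] /eqP ->; rewrite /glab /gpos /=;
    case: o; rewrite eqxx ?orbT.
apply: (local_presents (u1 := [::]) (A := trivial_tangle) (B := B)) => //.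
- exact: bigon_sim.
- exact: bigon_sim_trivial.
- exact: bigon_det.
Qed.

Lemma gwf_plug_rev u1 u2 u3 u4 T : gwf (plug u1 u2 u3 u4 (rev_tangle T)) <->
  gwf (plug u1 u2 u3 u4 T).
Proof.
have P : perm_eq (plug u1 u2 u3 u4 (rev_tangle T)) (plug u1 u2 u3 u4 T).
  by apply/permP => a; rewrite /plug !count_cat !count_rev.
by split; apply: gwf_perm; rewrite // perm_sym.
Qed.

Lemma presents_triangle u1 u2 u3 u4 p q r s1 s2 s3 t h12 h13 h23 :
  let T : tangle := tri_segs p q r s1 s2 s3 t h12 h13 h23 in
  acyclic3 h12 h13 h23 -> gwf (plug u1 u2 u3 u4 T) ->
  forall Q (op : int -> Q -> Q -> Q),
  (exists g, presents_IndQ (plug u1 u2 u3 u4 T) op g) <->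
  (exists g, presents_IndQ (plug u1 u2 u3 u4 (rev_tangle T)) op g).
Proof.
move=> T Hh H; have H' := (gwf_plug_rev u1 u2 u3 u4 T).2 H.
have Hc x : x \in letters T -> (count (fun y => glab y == glab x) (letters T) <= 2)%N.
  move=> xT; have [|<- _ _] := H x.
    by move: xT; rewrite /plug /letters !mem_cat;
      do ?case/orP => [->|]; rewrite ?orbT // => ->; rewrite ?orbT.
  rewrite /plug /letters !count_cat; lia.
have [pq pr qr] : [/\ p != q, p != r & q != r].
  have := Hc (p, h12, tsign h12 s1 s2 t); have := Hc (q, h13, tsign h13 s1 s3 t).
  rewrite /T /letters /tri_segs.
  move: (tsign h12 s1 s2 t) (tsign h13 s1 s3 t) (tsign h23 s2 s3 t) => g12 g13 g23.
  by case: (s1); case: (s2); case: (s3); rewrite /= !inE !eqxx ?orbT => /(_ isT) + /(_ isT);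
    rewrite /glab /= ?eqxx ?(eq_sym q) ?(eq_sym r p);
    case: (p == q); case: (p == r); case: eqP.
have fr s1' s2' s3' : gwf (plug u1 u2 u3 u4 (tri_segs p q r s1' s2' s3' t h12 h13 h23)) ->
    fresh_outer u1 u2 u3 u4 (tri_segs p q r s1' s2' s3' t h12 h13 h23).
  by move=> Hw; apply: plug_fresh => // y o; apply: tri_letters_mate.
rewrite tri_segs_rev in H' *; apply: local_presents => //; try exact: fr; try exact: tri_det.
- exact: tri_sim.
(* The inverse move is the same move with all orientations negated. *)
- have := @tri_sim p q r pq pr qr (~~ s1) (~~ s2) (~~ s3) t h12 h13 h23 Hh.
  by rewrite !negbK.
Qed.

(** * Invariance along chains of moves *)

Lemma gstep_presents w w' : gstep w w' ->
  (gwf w <-> gwf w') /\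
  (gwf w -> forall Q (op : int -> Q -> Q -> Q),
    (exists g, presents_IndQ w op g) <-> (exists g, presents_IndQ w' op g)).
Proof.
case=> {w w'}.
- move=> n w; split; first by apply: iff_sym; apply: gwf_rot.
  by move=> Hw Q op; apply: presents_rot.
- move=> f w f_inj; split; first by apply: iff_sym; apply: gwf_relab.
  by move=> Hw Q op; apply: presents_relab.
- by move=> u v x s H H'; split=> // _; apply: (presents_curl (o := true)).
- by move=> u v x s H H'; split=> // _; apply: (presents_curl (o := false)).
- by move=> u1 u2 u3 x y s H H'; split=> // _; apply: (presents_bigon (sw := false)).
- move=> u1 u2 u3 x y s H H'; split=> // _.
  (* The under-strand meets [y] first, so [y] is the first crossing of the bigon and its sign is
     [~~ s]. *)
  have := @presents_bigon u1 u2 u3 true y x (~~ s); rewrite /= negbK => P.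
  exact: P.
- move=> u1 u2 u3 u4 p q r s1 s2 s3 t h12 h13 h23 S1 S2 S3 E Hh H.
  split.
    apply: iff_sym; exact: (gwf_plug_rev u1 u2 u3 u4 (S1, S2, S3)).
  move=> _ Q op.
  have := @presents_triangle u1 u2 u3 u4 p q r s1 s2 s3 t h12 h13 h23 Hh.
  by rewrite E; apply.
Qed.

(** The same [Q] and [op] serve along the whole chain, only the generating map changes, so steps
    compose as equivalences. Well-formedness is carried along because each step requires it. *)
Lemma greid_equiv_presents w w' : greid_equiv w w' ->
  (gwf w <-> gwf w') /\
  (gwf w -> forall Q (op : int -> Q -> Q -> Q),
    (exists g, presents_IndQ w op g) <-> (exists g, presents_IndQ w' op g)).
Proof.
elim=> {w w'} [w w' /gstep_presents //|w //|w w' _ [H1 H2]|w1 w2 w3 _ [H1 H2] _ [H3 H4]].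
  split; first exact: iff_sym.
  by move=> /H1 Hw Q op; apply: iff_sym; apply: H2.
split; first exact: iff_trans H1 H3.
move=> Hw Q op; apply: iff_trans (H2 Hw Q op) _.
by apply: H4; apply/H1.
Qed.

(** Each universal property gives a map to the other model; both composites fix the generators, so
    they are identities by uniqueness. *)
Lemma presents_unique w Q opQ gQ Q' opQ' gQ' :
  @presents_IndQ w Q opQ gQ -> @presents_IndQ w Q' opQ' gQ' ->
  exists f : Q -> Q', iq_iso opQ opQ' f.
Proof.
move=> [HQ rQ uQ] [HQ' rQ' uQ'].
have [f [[hf gf] _]] := uQ _ _ _ HQ' rQ'.
have [k [[hk gk] _]] := uQ' _ _ _ HQ rQ.
exists f; split=> //; exists k => x.
- have [h [_ hu]] := uQ _ _ _ HQ rQ.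
  transitivity (h x).
    rewrite (hu (k \o f)) //; split; first by move=> i a b /=; rewrite hf hk.
    by move=> a aw /=; rewrite gf // gk.
  by rewrite (hu id).
- have [h [_ hu]] := uQ' _ _ _ HQ' rQ'.
  transitivity (h x).
    rewrite (hu (f \o k)) //; split; first by move=> i a b /=; rewrite hk hf.
    by move=> a aw /=; rewrite gk // gf.
  by rewrite (hu id).
Qed.

Theorem theorem5p5 (w w' : gword) :
  gwf w -> gwf w' -> greid_equiv w w' ->
  forall (Q : Type) (opQ : int -> Q -> Q -> Q) (gQ : option nat -> Q)
         (Q' : Type) (opQ' : int -> Q' -> Q' -> Q') (gQ' : option nat -> Q'),
    presents_IndQ w opQ gQ -> presents_IndQ w' opQ' gQ' ->
    exists f : Q -> Q', iq_iso opQ opQ' f.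
Proof.
move=> Hw _ /greid_equiv_presents [_ /(_ Hw) E] Q opQ gQ Q' opQ' gQ' HQ HQ'.
have [g Hg] := (E Q opQ).1 (ex_intro _ gQ HQ).
exact: presents_unique Hg HQ'.
Qed.
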